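(* Let $H$ satisfy the standing assumptions (H), let $m\in\mathscr C^2(\mathbb T^d)$ and let $A\in\mathscr C^2(\mathbb T^d;\mathbb R^d)$ be a vector field such that (i) there exists an $A$-invariant probability measure with a smooth, positive density, and (ii) the set of $A$-invariant probability measures with $\mathscr C^2$ density is dense in $\mathcal P_A(\mathbb T^d)$ for the weak-$*$ topology. For $\varepsilon>0$ let $\lambda_H(\varepsilon,A)$ be the eigenvalue of $\varepsilon(-\Delta+H(\nabla_x\cdot))+\langle A,\nabla_x\cdot\rangle+m$. Then \[\lambda_H(\varepsilon,A)\xrightarrow[\varepsilon\to0]{}-\max_{\eta\in\mathcal P_A(\mathbb T^d)}\int_{\mathbb T^d}m\,d\eta.\]
   Context: $\mathbb T^d$ is the $d$-dimensional torus; $\mathcal P(\mathbb T^d)$ is the set of Borel probability measures on $\mathbb T^d$. Standing assumptions (H) on $H:\mathbb R^d\to\mathbb R$: $H$ is $\mathscr C^2$; $H(p)>H(0)=0$ for $p\neq0$; $\nabla^2_{pp}H(p)$ is symmetric positive definite for $p\neq 0$; there is a continuous, coercive, convex, non-negative function $\mathcal H$ on $[0,\infty)$ with $\mathcal H(a)>\mathcal H(0)=0$ for $a>0$ such that $\mathcal H\big(\|f-\frac{1}{|\mathbb T^d|}\int_{\mathbb T^d}f\|_{L^1(\mathbb T^d)}\big)\le\int_{\mathbb T^d}H(\nabla f)$ for every $f\in\mathscr C^2(\mathbb T^d)$; and there is $\beta\in(0,1)$ with $aH(p)\ge H(a^\beta p)$ for all $a\in(0,1)$, $p\in\mathbb R^d$.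 $A$-invariant measures: $\eta\in\mathcal P(\mathbb T^d)$ is $A$-invariant if $\int_{\mathbb T^d}\langle A,\nabla\phi\rangle\,d\eta=0$ for all $\phi\in\mathscr C^2(\mathbb T^d)$ (i.e. $\nabla\cdot(A\eta)=0$ in the sense of distributions); $\mathcal P_A(\mathbb T^d)$ is the set of such measures. Eigenvalue: the eigenvalue of $\varepsilon(-\Delta+H(\nabla_x\cdot))+\langle A,\nabla_x\cdot\rangle+m$ is the unique real $\lambda$ for which there exists $\varphi\in\mathscr C^2(\mathbb T^d)$ with $\lambda+\varepsilon(-\Delta\varphi+H(\nabla\varphi))+\langle A,\nabla\varphi\rangle=-m$ on $\mathbb T^d$. *)

(* Defs.v *)
From HB Require Import structures.
From mathcomp Require Import all_boot all_order all_algebra.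
From mathcomp Require Import all_classical all_reals all_analysis.

Set Implicit Arguments.
Unset Strict Implicit.
Unset Printing Implicit Defensive.

Import Order.TTheory GRing.Theory Num.Theory.
Import numFieldNormedType.Exports.
Local Open Scope classical_set_scope.
Local Open Scope ring_scope.

(* The torus T^d = R^d / Z^d.  Functions on T^d are represented as
   Z^d-periodic functions on R^d = 'rV[R]_d; probability measures on T^d are
   represented as probability measures on R^d (realised as d.-tuple R with its
   product = Borel sigma-algebra) that are concentrated on the fundamental
   cell [0,1)^d.  The Lebesgue measure of T^d is the one of [0,1)^d (|T^d|=1). *)

Section Torus.
Context {R : realType} {d : nat}.

Definition ebasis (i : 'I_d) : 'rV[R]_d := delta_mx 0 i.

Definition periodic (f : 'rV[R]_d -> R) : Prop :=
  forall (x : 'rV[R]_d) (i : 'I_d), f (x + ebasis i) = f x.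

Definition partial (i : 'I_d) (f : 'rV[R]_d -> R) : 'rV[R]_d -> R :=
  fun x => derive f x (ebasis i).

Fixpoint Ck (k : nat) (f : 'rV[R]_d -> R) : Prop :=
  match k with
  | 0 => continuous f
  | k'.+1 => continuous f /\
      forall i : 'I_d, (forall x, derivable f x (ebasis i)) /\ Ck k' (partial i f)
  end.

Definition smooth (f : 'rV[R]_d -> R) : Prop := forall k, Ck k f.

Definition CkT (k : nat) (f : 'rV[R]_d -> R) : Prop := periodic f /\ Ck k f.
Definition smoothT (f : 'rV[R]_d -> R) : Prop := periodic f /\ smooth f.
Definition contT (f : 'rV[R]_d -> R) : Prop := periodic f /\ continuous f.

Definition grad (f : 'rV[R]_d -> R) (x : 'rV[R]_d) : 'rV[R]_d :=
  \row_i partial i f x.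

Definition laplacian (f : 'rV[R]_d -> R) (x : 'rV[R]_d) : R :=
  \sum_i partial i (partial i f) x.

Definition dotp (u v : 'rV[R]_d) : R := \sum_i u 0 i * v 0 i.

Definition hessian (f : 'rV[R]_d -> R) (p : 'rV[R]_d) : 'M[R]_d :=
  \matrix_(i, j) partial i (partial j f) p.

Definition row_of_tuple (x : d.-tuple R) : 'rV[R]_d := \row_i tnth x i.

Definition cell : set (d.-tuple R) :=
  [set x | forall i : 'I_d, 0 <= tnth x i < 1].

End Torus.

(* Lebesgue integral over [0,1]^d, computed as an iterated integral
   (Fubini--Tonelli) of one-dimensional Lebesgue integrals. *)
Fixpoint cell_int {R : realType} (n : nat) : (n.-tuple R -> R) -> R :=
  match n return (n.-tuple R -> R) -> R with
  | 0 => fun f => f [tuple]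
  | n'.+1 => fun f =>
      Rintegral (@lebesgue_measure R) `[0%R, 1%R]
        (fun t => cell_int (fun x : n'.-tuple R => f [tuple of t :: x]))
  end.

Section TorusMeasures.
Context {R : realType} {d : nat}.

Definition torus_int (f : 'rV[R]_d -> R) : R :=
  cell_int (fun x : d.-tuple R => f (row_of_tuple x)).

Definition torus_prob (eta : probability (d.-tuple R) R) : Prop :=
  eta (~` (@cell R d)) = 0%E.

Definition meas_int (eta : probability (d.-tuple R) R) (f : 'rV[R]_d -> R) : R :=
  fine (\int[eta]_x (f (row_of_tuple x))%:E)%E.

Definition has_density (eta : probability (d.-tuple R) R) (rho : 'rV[R]_d -> R)
  : Prop :=
  forall B : set (d.-tuple R), measurable B ->
    eta B = (cell_int (fun x : d.-tuple R => \1_B x * rho (row_of_tuple x)))%:E.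

(* A-invariant probability measures on T^d: div(A eta) = 0 *)
Definition A_invariant (A : 'rV[R]_d -> 'rV[R]_d)
  (eta : probability (d.-tuple R) R) : Prop :=
  torus_prob eta /\
  forall phi : 'rV[R]_d -> R, CkT 2 phi ->
    meas_int eta (fun x => dotp (A x) (grad phi x)) = 0.

Definition assumptions_H (H : 'rV[R]_d -> R) : Prop :=
  Ck 2 H /\
  H 0 = 0 /\ (forall p, p != 0 -> 0 < H p) /\
  (forall p, p != 0 -> (hessian H p)^T = hessian H p /\
     forall v : 'rV[R]_d, v != 0 -> 0 < (v *m hessian H p *m v^T) 0 0) /\
  (exists cH : R -> R,
     {within `[0%R, +oo[, continuous cH} /\
     (forall M : R, exists r : R, forall a : R, r <= a -> M <= cH a) /\
     (forall a b t : R, 0 <= a -> 0 <= b -> 0 <= t <= 1 ->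
        cH (t * a + (1 - t) * b) <= t * cH a + (1 - t) * cH b) /\
     (forall a : R, 0 <= a -> 0 <= cH a) /\
     cH 0 = 0 /\ (forall a : R, 0 < a -> cH 0 < cH a) /\
     (forall f : 'rV[R]_d -> R, CkT 2 f ->
        cH (torus_int (fun x => `|f x - torus_int f|)) <=
        torus_int (fun x => H (grad f x)))) /\
  (exists beta : R, 0 < beta < 1 /\
     forall (a : R) (p : 'rV[R]_d), 0 < a < 1 -> H (a `^ beta *: p) <= a * H p).

Definition is_eigenvalue (H : 'rV[R]_d -> R) (A : 'rV[R]_d -> 'rV[R]_d)
  (m : 'rV[R]_d -> R) (eps lam : R) : Prop :=
  exists phi : 'rV[R]_d -> R, CkT 2 phi /\
    forall x, lam + eps * (- laplacian phi x + H (grad phi x))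
                  + dotp (A x) (grad phi x) = - m x.

End TorusMeasures.

(* Main.v *)
Require Import Defs.
From HB Require Import structures.
From mathcomp Require Import all_boot all_order all_algebra.
From mathcomp Require Import all_classical all_reals all_analysis.
From mathcomp Require Import measurable_realfun ring lra.
Import Order.TTheory GRing.Theory Num.Theory.
Import numFieldNormedType.Exports.
Local Open Scope classical_set_scope.
Local Open Scope ring_scope.

Set Implicit Arguments.
Unset Strict Implicit.
Unset Printing Implicit Defensive.

(* Put M = max_(P_A) int m.  For an invariant eta with C^2 density rho, integrating the
   equation against eta removes the drift, and since H >= 0,
     lam <= - int m d eta + eps int (phi - <phi>) (lap rho).
   With rho bounded below, the same identity and the growth assumptions on H bound
   eps^beta ||phi - <phi>||_1, so the last term vanishes as eps -> 0; density of such
   eta gives limsup lam <= - M.  For the lower bound, Hahn-Banach duality gives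
     M = inf_psi sup (m + <A, grad psi>),
   and comparing phi with a near-optimal psi at a minimum of phi - psi yields
   lam >= - M - delta - C eps.  The maximizing measure comes from a Hahn-Banach mean L
   on bounded functions over the cell, with L <A, grad psi> = 0: a weak-* limit is
   realised as the law of a random variable on [0, 1], obtained by splitting [0, 1]
   successively according to the L-masses of half-spaces {x_i < q}. *)

(** * Sublinear functionals and the Hahn-Banach theorem *)

(** Two invariant measures play different roles. Densities supplied by (ii) may vanish, so they give
    no control of [H (grad phi)] in Lebesgue measure; the positive density of (i) does, and yields
    the bound on the oscillation of [phi]. As that bound concerns [phi] alone, it can be inserted in
    the identity written for a density from (ii), of which only a bound on the Laplacian is then
    required. The infimum over [psi] is finite because a drift [<A, grad psi>] vanishes at a minimum
    of [psi]. Hahn-Banach on bounded functions yields only a finitely additive mean. Countable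
    additivity is recovered because the test functions are continuous: up to a small error their
    values are determined by finitely many half-spaces, for which finite additivity is enough, and
    Lebesgue measure on [0, 1] supplies a countably additive law. *)

Definition sublinear (R : realType) (V : lmodType R) (p : V -> R) :=
  (forall x y, p (x + y) <= p x + p y) /\
  (forall a x, 0 <= a -> p (a *: x) = a * p x).

(** Applying the inequality to [a^-1] and [a *: x] gives the reverse one, so functionals defined by
    infima need only one direction. *)
Lemma sublinear_intro (R : realType) (V : lmodType R) (p : V -> R) :
  (forall x y, p (x + y) <= p x + p y) -> p 0 = 0 ->
  (forall a x, 0 < a -> p (a *: x) <= a * p x) -> sublinear p.
Proof.
move=> pD p0 pZ; split=> // a x; rewrite le_eqVlt => /predU1P[<-|a0].
  by rewrite scale0r mul0r.
apply/eqP; rewrite eq_le pZ//= -ler_pdivlMl//.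
by rewrite -{1}(scale1r x) -(mulVf (lt0r_neq0 a0)) -scalerA pZ// invr_gt0.
Qed.

Lemma sublinear0 (R : realType) (V : lmodType R) (p : V -> R) :
  sublinear p -> p 0 = 0.
Proof. by move=> [_ pZ]; rewrite -(scale0r 0) pZ// mul0r. Qed.

Lemma sublinearN_le (R : realType) (V : lmodType R) (p : V -> R) x :
  sublinear p -> - p (- x) <= p x.
Proof.
by move=> sp; rewrite lerNl -subr_ge0 opprK addrC -(sublinear0 sp)
  -(addrN x); exact: (proj1 sp).
Qed.

(** The functional is [q x = inf_(t >= 0) (p (x + t y) - t p y)]. Subadditivity bounds it below by
    [- p (- x)]; [t = 0] gives [q <= p], and [t = 1] at [- y] gives the last inequality. *)
Lemma sublinear_shift (R : realType) (V : lmodType R) (p : V -> R) y :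
  sublinear p -> exists q, [/\ sublinear q, forall x, q x <= p x &
    q (- y) <= - p y].
Proof.
move=> sp; have [pD pZ] := sp.
pose S x := [set p (x + t *: y) - t * p y | t in [set t : R | 0 <= t]].
have Sn0 x : S x !=set0 by exists (p (x + 0 *: y) - 0 * p y); exists 0 => /=.
have lbS x : lbound (S x) (- p (- x)).
  move=> _ [t /= t0 <-]; rewrite lerBrDr addrC lerBlDr -pZ//.
  by rewrite -{1}(addKr x (t *: y)) addrC; exact: pD.
have infle x t : 0 <= t -> inf (S x) <= p (x + t *: y) - t * p y.
  by move=> t0; apply: ge_inf; [exists (- p (- x)) | exists t].
have leinf x c : (forall t, 0 <= t -> c <= p (x + t *: y) - t * p y) ->
    c <= inf (S x).
  by move=> h; apply: lb_le_inf => // _ [t /= t0 <-]; exact: h.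
exists (fun x => inf (S x)); split; first apply: sublinear_intro.
- move=> x x'; rewrite -lerBlDr; apply: (leinf) => t t0.
  rewrite lerBlDr [leRHS]addrC -lerBlDr; apply: (leinf) => s s0; rewrite lerBlDr.
  apply: (le_trans (infle _ (t + s) _)); first exact: addr_ge0.
  have := pD (x + t *: y) (x' + s *: y).
  rewrite addrACA -scalerDl; lra.
- apply/eqP; rewrite eq_le; apply/andP; split.
    by rewrite (le_trans (infle _ 0 _))// scale0r addr0 mul0r subr0 (sublinear0 sp).
  by apply: (leinf) => t t0; rewrite add0r pZ// subrr.
- move=> a x a0; rewrite mulrC -ler_pdivrMr//; apply: (leinf) => t t0.
  rewrite ler_pdivrMr// (le_trans (infle _ (a * t) _))//.
    by rewrite mulr_ge0// ltW.
  rewrite -scalerA -scalerDr (pZ _ _ (ltW a0)) le_eqVlt; apply/orP; left; apply/eqP; ring.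
- by move=> x; rewrite (le_trans (infle _ 0 _))// scale0r addr0 mul0r subr0.
- by rewrite (le_trans (infle _ 1 _))// scale1r addNr mul1r (sublinear0 sp) sub0r.
Qed.

(* Minimal sublinear functionals are linear, so Zorn's lemma applies directly
   to sublinear functionals and no partially defined functional is needed. *)
Lemma sublinear_minorant_linear (R : realType) (V : lmodType R) (p : V -> R) :
  sublinear p -> exists2 L : V -> R, (forall x, L x <= p x) &
    (forall a x y, L (a *: x + y) = a * L x + L y).
Proof.
move=> sp.
pose T := {q : V -> R | sublinear q /\ forall x, q x <= p x}.
(* The order is reversed, so that a maximal element in Zorn's lemma is a minimal functional. *)
pose le (s t : T) : bool := `[< forall x, sval t x <= sval s x >].
have [| | | |[q [sq qp]] qmin] := @Zorn T le.
- by move=> t; apply/asboolP.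
- move=> r s t /asboolP rs /asboolP st; apply/asboolP => x.
  exact: le_trans (st x) (rs x).
- move=> [s ps] [t pt] /asboolP/= st /asboolP/= ts; apply: eq_exist.
  by apply/funext => x; apply/eqP; rewrite eq_le st ts.
- move=> A totA; have [[a0 Aa0]|nA] := pselect (exists a, A a); last first.
    by exists (exist _ p (conj sp (fun x => lexx _))) => s As; exfalso; apply: nA; exists s.
  (* A chain is bounded by its pointwise infimum, finite because every member is above [- p (- x)].
     Subadditivity uses that two members of the chain are comparable. *)
  pose S x := [set sval q x | q in A].
  have infle x q : A q -> inf (S x) <= sval q x.
    move=> Aq; apply: ge_inf; last by exists q.
    exists (- p (- x)) => _ [r Ar <-]; have [sr rp] := svalP r.
    by rewrite (le_trans _ (sublinearN_le _ sr))// lerN2.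
  have leinf x c : (forall q, A q -> c <= sval q x) -> c <= inf (S x).
    move=> h; apply: lb_le_inf; first by exists (sval a0 x); exists a0.
    by move=> _ [q Aq <-]; exact: h.
  suff si : sublinear (fun x => inf (S x)) /\ forall x, inf (S x) <= p x.
    by exists (exist _ (fun x => inf (S x)) si) => s As; apply/asboolP => x /=; exact: (infle).
  split; last by move=> x; rewrite (le_trans (infle _ _ Aa0))//; case: (svalP a0).
  apply: sublinear_intro.
  + move=> x y; rewrite -lerBlDr; apply: (leinf) => s As.
    rewrite lerBlDr [leRHS]addrC -lerBlDr; apply: (leinf) => t At.
    rewrite lerBlDr [leRHS]addrC.
    have [/asboolP st|/asboolP ts] := totA _ _ As At.
      rewrite (le_trans (infle _ _ At))// (le_trans ((svalP t).1.1 _ _))//.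
      by rewrite lerD2r.
    rewrite (le_trans (infle _ _ As))// (le_trans ((svalP s).1.1 _ _))//.
    by rewrite lerD2l.
  + apply/eqP; rewrite eq_le (le_trans (infle _ _ Aa0)) /=; last first.
      by rewrite (sublinear0 (svalP a0).1).
    by apply: (leinf) => r Ar; rewrite (sublinear0 (svalP r).1).
  + move=> a x a0'; rewrite mulrC -ler_pdivrMr//; apply: (leinf) => t At.
    by rewrite ler_pdivrMr// mulrC -((svalP t).1.2 _ _ (ltW a0')) infle.
exists q => //.
(* The shift of [q] along [y] lies below [q], hence equals it by minimality; its value at [- y]
   makes [q] odd. *)
have qN y : q (- y) = - q y.
  have [r [sr rq ry]] := sublinear_shift y sq.
  have rp x : r x <= p x by exact: le_trans (rq x) (qp x).
  have : le (exist _ q (conj sq qp)) (exist _ r (conj sr rp)) by apply/asboolP.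
  move=> /qmin /(congr1 sval) /= rE; apply/eqP; rewrite eq_le -{1}rE ry/=.
  by have := sublinearN_le y sq; rewrite lerNl.
have qD x y : q (x + y) = q x + q y.
  apply/eqP; rewrite eq_le sq.1/= -lerBrDr -qN.
  by rewrite -{1}(addrK y x) sq.1.
move=> a x y; rewrite qD; congr (_ + _).
have [a0|/ltW a0] := leP 0 a; first exact: sq.2.
rewrite -{1}[a]opprK scaleNr qN (sq.2 (- a)) ?mulNr ?opprK//.
by rewrite oppr_ge0.
Qed.

(** Shifting along [y] before taking a linear minorant gives [L (- y) <= - p y], which forces
    equality at [y]. *)
Lemma hahn_banach (R : realType) (V : lmodType R) (p : V -> R) (y : V) :
  sublinear p -> exists L : V -> R, [/\ forall x, L x <= p x,
    forall a x z, L (a *: x + z) = a * L x + L z & L y = p y].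
Proof.
move=> sp; have [q [sq qp qy]] := sublinear_shift y sp.
have [L Lq Llin] := sublinear_minorant_linear sq.
have Lp x : L x <= p x by exact: le_trans (Lq x) (qp x).
exists L; split => //; apply/eqP; rewrite eq_le Lp/=.
have L0 : L 0 = 0.
  have := Llin 1 0 0; rewrite scale1r addr0 mul1r => /eqP.
  by rewrite -subr_eq0 opprD addNKr oppr_eq0 => /eqP.
rewrite -lerN2 (le_trans _ qy)// (le_trans _ (Lq _))//.
have := Llin (-1) y 0; rewrite addr0 scaleN1r => ->.
by rewrite L0 addr0 mulN1r.
Qed.

(** * Means on bounded functions *)

Section BoundedFunctions.
Context {R : realType} {T : Type}.

Definition bounded_pred : {pred (T -> R)} :=
  fun f => `[< exists M : R, forall x, `|f x| <= M >].

Lemma bounded_predP (f : T -> R) :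
  reflect (exists M : R, forall x, `|f x| <= M) (f \in bounded_pred).
Proof. exact: asboolP. Qed.

Lemma bounded_pred_submod : submod_closed bounded_pred.
Proof.
split=> [|a f g /bounded_predP[M fM] /bounded_predP[N gN]].
  by apply/bounded_predP; exists 0 => x; rewrite /= normr0.
apply/bounded_predP; exists (`|a| * M + N) => x.
rewrite (le_trans (ler_normD _ _))// lerD ?gN//.
by rewrite normrM ler_wpM2l.
Qed.

HB.instance Definition _ :=
  GRing.isSubmodClosed.Build R (T -> R) bounded_pred bounded_pred_submod.

Definition bounded_fun := {f : T -> R | f \in bounded_pred}.

HB.instance Definition _ := SubChoice.on bounded_fun.
HB.instance Definition _ :=
  [SubChoice_isSubLmodule of bounded_fun by <:].

End BoundedFunctions.

(** A finitely additive probability on all subsets of [T], seen as a functional. Positivity and the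
    value on constants follow from the upper bound applied to [f] and [- f]; values at unbounded
    functions are junk. *)
Definition is_mean (R : realType) (T : Type) (L : (T -> R) -> R) :=
  (forall a f g, f \in bounded_pred -> g \in bounded_pred ->
     L (fun x => a * f x + g x) = a * L f + L g) /\
  (forall f M, f \in bounded_pred -> (forall x, f x <= M) -> L f <= M).

(** Hahn-Banach for [p f = inf_(g in G) sup (f + g)], normed at [m]. Each [g] being non-negative
    somewhere keeps [p] finite, and [p <= 0] on the subspace [G] forces [L = 0] there. Since [L m]
    is the infimum itself, near-optimal [g] exist. *)
Lemma mean_separation (R : realType) (T : Type) (G : set (T -> R))
    (m : T -> R) :
  m \in bounded_pred ->
  (forall g, G g -> g \in bounded_pred /\ exists x, 0 <= g x) ->
  G (fun=> 0) ->
  (forall a f g, G f -> G g -> G (fun x => a * f x + g x)) ->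
  exists L, [/\ is_mean L, forall g, G g -> L g = 0 &
    forall delta, 0 < delta ->
      exists2 g, G g & forall x, m x + g x <= L m + delta].
Proof.
move=> bm bG G0 Glin.
pose S (f : T -> R) := [set c | exists2 g, G g & forall x, f x + g x <= c].
have lbS (f : T -> R) M : (forall x, `|f x| <= M) -> lbound (S f) (- M).
  move=> fM c [g Gg fgc]; have [x gx] := (bG g Gg).2.
  rewrite (le_trans _ (fgc x))//.
  by have := fM x; rewrite ler_norml => /andP[? _]; lra.
have S0 (f : bounded_fun) : S (val f) !=set0.
  have /bounded_predP[M fM] := valP f; exists M; exists (fun=> 0) => // x.
  by rewrite addr0 (le_trans (ler_norm _)).
have infle (f : bounded_fun) c : S (val f) c -> inf (S (val f)) <= c.
  move=> Sc; apply: ge_inf => //; have /bounded_predP[M fM] := valP f.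
  by exists (- M); exact: lbS.
have leinf (f : bounded_fun) c : (forall g e, G g ->
    (forall x, val f x + g x <= e) -> c <= e) -> c <= inf (S (val f)).
  by move=> h; apply: lb_le_inf => // e [g Gg ge]; exact: (h g).
pose p (f : bounded_fun) := inf (S (val f)).
have sp : sublinear p.
  apply: sublinear_intro.
  - move=> f f'; rewrite -lerBlDr; apply: (leinf) => g e Gg ge.
    rewrite lerBlDr [leRHS]addrC -lerBlDr; apply: (leinf) => g' e' Gg' ge'.
    rewrite lerBlDr; apply: infle; exists (fun x => 1 * g x + g' x).
      exact: Glin.
    move=> x; have := ge x; have := ge' x.
    by rewrite -[val (f + f') x]/(val f x + val f' x) mul1r; lra.
  - apply/eqP; rewrite eq_le; apply/andP; split.
      by apply: infle; exists (fun=> 0) => // x; rewrite /= addr0.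
    apply: leinf => g e Gg ge; have [x gx] := (bG g Gg).2.
    by rewrite (le_trans _ (ge x))//= add0r.
  - move=> a f a0; rewrite mulrC -ler_pdivrMr//; apply: (leinf) => g e Gg ge.
    rewrite ler_pdivrMr//; apply: infle; exists (fun x => a * g x + 0).
      exact: Glin.
    move=> x; have -> : val (a *: f) x = a * val f x by [].
    by rewrite addr0 -mulrDr [leRHS]mulrC ler_pM2l.
have [L0 [L0p L0lin L0m]] := hahn_banach (Sub m bm : bounded_fun) sp.
have bK (f : T -> R) (bf : f \in bounded_pred) :
    val (insubd (0 : bounded_fun) f) = f by rewrite insubdK.
(* [insubd] sends unbounded functions to 0, which makes [L] total. *)
pose L (f : T -> R) := L0 (insubd 0 f).
have Llin a f g : f \in bounded_pred -> g \in bounded_pred ->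
    L (fun x => a * f x + g x) = a * L f + L g.
  move=> bf bg; rewrite /L -L0lin; congr L0; apply: val_inj.
  rewrite bK; last exact: (bounded_pred_submod.2 a).
  by rewrite /= !bK.
have Lle f M : f \in bounded_pred -> (forall x, f x <= M) -> L f <= M.
  move=> bf fM; rewrite /L (le_trans (L0p _))//; apply: infle.
  by exists (fun=> 0) => // x; rewrite bK// addr0.
have LG g : G g -> L g <= 0.
  move=> Gg; rewrite /L (le_trans (L0p _))//; apply: infle.
  exists (fun x => -1 * g x + 0); first exact: Glin.
  by move=> x; rewrite bK ?(bG _ Gg).1//; lra.
exists L; split=> // [g Gg|delta d0].
  apply/eqP; rewrite eq_le LG//=.
  have b0 : (fun=> 0 : R) \in @bounded_pred R T by exact: bounded_pred_submod.1.
  have L00 : L (fun=> 0) = 0.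
    have := Llin (-1) _ _ b0 b0.
    have -> : (fun x : T => -1 * 0 + 0) = (fun=> 0 : R).
      by apply/funext => x; rewrite mulr0 addr0.
    lra.
  have := LG _ (Glin (-1) _ _ Gg G0).
  by rewrite Llin ?(bG _ Gg).1// L00; lra.
have LmE : L m = p (Sub m bm).
  by rewrite -L0m /L; congr L0; apply: val_inj; rewrite bK.
have [|e [g Gg ge] elt] := @inf_adherent _ (S m) delta d0.
  split; first exact: (S0 (Sub m bm)).
  by have /bounded_predP[M mM] := bm; exists (- M); exact: lbS.
exists g => // x; rewrite (le_trans (ge x))// LmE; exact: ltW.
Qed.

(** * Bounded measurable functions and iterated integrals *)

Section BoundedMeasurable.
Context {R : realType} {d : measure_display} {T : measurableType d}.
Implicit Types f g : T -> R.

(** This class is stable under products, sections and partial integration, so it provides every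
    integrability condition met in iterated integrals. *)
Definition bmeas f := measurable_fun setT f /\ f \in bounded_pred.

Lemma bmeas_cst c : bmeas (fun=> c).
Proof.
split; first exact: measurable_cst.
by apply/bounded_predP; exists `|c|.
Qed.

Lemma bmeas_lin a f g : bmeas f -> bmeas g -> bmeas (fun x => a * f x + g x).
Proof.
move=> [mf bf] [mg bg]; split; last exact: (bounded_pred_submod.2 a).
by apply: measurable_funD => //; apply: measurable_funM.
Qed.

Lemma bmeasD f g : bmeas f -> bmeas g -> bmeas (fun x => f x + g x).
Proof.
move=> bf bg; rewrite (_ : (fun _ => _) = fun x => 1 * f x + g x).
  exact: bmeas_lin.
by apply/funext => x; rewrite mul1r.
Qed.

Lemma bmeasM f g : bmeas f -> bmeas g -> bmeas (fun x => f x * g x).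
Proof.
move=> [mf /bounded_predP[M fM]] [mg /bounded_predP[N gN]].
split; first exact: measurable_funM.
by apply/bounded_predP; exists (M * N) => x; rewrite normrM ler_pM.
Qed.

Lemma bmeas_indic (A : set T) : measurable A -> bmeas (\1_A : T -> R).
Proof.
move=> mA; split; first exact: measurable_indic.
apply/bounded_predP; exists 1 => x.
by rewrite ger0_norm ?indicE// lern1 leq_b1.
Qed.

Lemma bmeas_comp {d' : measure_display} {T' : measurableType d'} f (h : T' -> T) :
  bmeas f -> measurable_fun setT h -> measurable_fun setT (f \o h) /\
  f \o h \in bounded_pred.
Proof.
move=> [mf /bounded_predP[M fM]] mh; split; first exact: measurableT_comp.
by apply/bounded_predP; exists M => x /=.
Qed.

Section Integral.
Variables (mu : {measure set T -> \bar R}) (D : set T).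
Hypotheses (mD : measurable D) (muD : (mu D < +oo)%E).

Lemma bmeas_integrable f : bmeas f -> mu.-integrable D (EFin \o f).
Proof.
move=> [mf /bounded_predP[M fM]]; apply: measurable_bounded_integrable => //.
  exact: measurable_funTS.
exists M; split; first exact: num_real.
by move=> N MN x _ /=; rewrite (le_trans (fM x))// ltW.
Qed.

Lemma bmeas_Rintegral_lin a f g : bmeas f -> bmeas g ->
  Rintegral mu D (fun x => a * f x + g x) =
  a * Rintegral mu D f + Rintegral mu D g.
Proof.
move=> bf bg; rewrite RintegralD//; last exact: bmeas_integrable.
  by rewrite RintegralZl//; exact: bmeas_integrable.
by apply: bmeas_integrable; apply: bmeasM => //; exact: bmeas_cst.
Qed.

Lemma bmeas_le_Rintegral f g : bmeas f -> bmeas g ->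
  (forall x, D x -> f x <= g x) -> Rintegral mu D f <= Rintegral mu D g.
Proof. by move=> bf bg; apply: le_Rintegral => //; exact: bmeas_integrable. Qed.

End Integral.
End BoundedMeasurable.

Section UnitInterval.
Context {R : realType}.
Notation leb := (@lebesgue_measure R).
Notation I01 f := (Rintegral leb `[0%R, 1%R] f).

Lemma lebesgue01 : leb `[0%R, 1%R] = 1%E.
Proof. by rewrite lebesgue_measure_itv/= lte01 oppr0 adde0. Qed.

Lemma lebesgue01_lty : (leb `[0%R, 1%R] < +oo)%E.
Proof. by rewrite lebesgue01 ltry. Qed.

Lemma I01_lin a (f g : R -> R) : bmeas f -> bmeas g ->
  I01 (fun x => a * f x + g x) = a * I01 f + I01 g.
Proof. exact: (bmeas_Rintegral_lin (mu := leb) (measurable_itv _) lebesgue01_lty). Qed.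

Lemma I01_cst (c : R) : I01 (fun=> c) = c.
Proof. by rewrite Rintegral_cst// [X in fine X]lebesgue01/= mulr1. Qed.

Lemma I01D_cst (f : R -> R) c : bmeas f ->
  I01 (fun x => f x + c) = I01 f + c.
Proof.
move=> bf; rewrite -[X in _ = _ + X]I01_cst -[X in X + _]mul1r -I01_lin//.
  by apply: eq_Rintegral => x _; rewrite mul1r.
exact: bmeas_cst.
Qed.

Lemma bmeas_sec1 {d1 d2} {T1 : measurableType d1} {T2 : measurableType d2}
  (f : T1 * T2 -> R) x : bmeas f -> bmeas (fun y => f (x, y)).
Proof. by move=> bf; apply: (bmeas_comp bf); exact: pair1_measurable. Qed.

Lemma bmeas_swap {d1 d2} {T1 : measurableType d1} {T2 : measurableType d2}
  (f : T1 * T2 -> R) : bmeas f -> bmeas (fun z : T2 * T1 => f (z.2, z.1)).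
Proof.
move=> bf; apply: (bmeas_comp bf (h := fun z : T2 * T1 => (z.2, z.1))).
exact: measurable_swap.
Qed.

(** Puts the integral in the form handled by Fubini-Tonelli: an extended-real integral over the
    whole line, with the interval as an indicator. *)
Lemma I01_ge0E {d} {T : measurableType d} (f : T * R -> R) :
  bmeas f -> (forall z, 0 <= f z) -> forall x,
  (I01 (fun t => f (x, t)))%:E =
    (\int[leb]_t (f (x, t) * \1_(`[0%R, 1%R]%classic) t)%:E)%E.
Proof.
move=> bf f0 x; rewrite Rintegral_mkcond /Rintegral patch_indic fineK//.
apply: integrable_fin_num => //.
have := bmeas_integrable (mu := leb) (D := `[0%R, 1%R]%classic).
move=> /(_ _ lebesgue01_lty _ (bmeas_sec1 x bf)).
move=> /(_ (measurable_itv _)) /integrable_mkcond.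
move=> /(_ (measurable_itv _)).
by rewrite restrict_EFin patch_indic.
Qed.

Lemma bmeas_I01 {d} {T : measurableType d} (f : T * R -> R) :
  bmeas f -> bmeas (fun x => I01 (fun t => f (x, t))).
Proof.
move=> bf; have [mf /bounded_predP[M fM]] := bf.
have bfx x := bmeas_sec1 x bf.
(* Adding the bound [M] makes the integrand non-negative, as Tonelli requires; [0, 1] has mass one,
   so the integral is shifted by exactly [M]. *)
pose g z := f z + M.
have bg : bmeas g by apply: bmeasD => //; exact: bmeas_cst.
have g0 z : 0 <= g z by have := fM z; rewrite ler_norml /g => /andP[? _]; lra.
split.
  rewrite (_ : (fun _ => _) = fun x => I01 (fun t => g (x, t)) + (- M)); last first.
    by apply/funext => x; rewrite /g I01D_cst// addrK.
  apply: measurable_funD; last exact: measurable_cst.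
  apply/measurable_EFinP.
  rewrite (_ : _ \o _ = fun x =>
    (\int[leb]_t (g (x, t) * \1_(`[0%R, 1%R]%classic) t)%:E)%E); last first.
    by apply/funext => x; rewrite /= I01_ge0E.
  apply: (@measurable_fun_fubini_tonelli_F _ _ _ _ R leb
    (fun z : T * R => (g z * \1_(`[0%R, 1%R]%classic) z.2)%:E)).
    apply/measurable_EFinP; apply: measurable_funM; first by case: bg.
    apply: (@measurableT_comp _ _ _ _ _ _ (\1_(`[0%R, 1%R]%classic) : R -> R)) => //.
  by move=> z; rewrite lee_fin mulr_ge0// indicE.
apply/bounded_predP; exists M => x.
rewrite ler_norml; apply/andP; split.
  rewrite -[leLHS]I01_cst; apply: bmeas_le_Rintegral => //.
  - exact: lebesgue01_lty.
  - exact: bmeas_cst.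
  - exact: bfx.
  - by move=> t _; have := fM (x, t); rewrite ler_norml => /andP[].
rewrite -[leRHS]I01_cst; apply: bmeas_le_Rintegral => //.
- exact: lebesgue01_lty.
- exact: bfx.
- exact: bmeas_cst.
- by move=> t _; have := fM (x, t); rewrite ler_norml => /andP[].
Qed.

(** Tonelli applied to [f + M]; the shift adds [M] to both sides. *)
Lemma I01_exchange (f : R * R -> R) : bmeas f ->
  I01 (fun s => I01 (fun t => f (s, t))) =
  I01 (fun t => I01 (fun s => f (s, t))).
Proof.
move=> bf; have [mf /bounded_predP[M fM]] := bf.
pose g z := f z + M.
have bg : bmeas g by apply: bmeasD => //; exact: bmeas_cst.
have g0 z : 0 <= g z by have := fM z; rewrite ler_norml /g => /andP[? _]; lra.
suff : I01 (fun s => I01 (fun t => g (s, t))) =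
       I01 (fun t => I01 (fun s => g (s, t))).
  have shift (h : R * R -> R) : bmeas h ->
      I01 (fun s => I01 (fun t => h (s, t) + M)) =
      I01 (fun s => I01 (fun t => h (s, t))) + M.
    move=> bh; rewrite -I01D_cst; last exact: bmeas_I01.
    by apply: eq_Rintegral => s _; rewrite I01D_cst//; exact: bmeas_sec1.
  have s1 := shift _ bf; have s2 := shift _ (bmeas_swap bf).
  by move=> s12; apply: (@addIr _ M); apply: etrans (esym s1) _; apply: etrans s12 s2.
pose J : R -> R := \1_(`[0%R, 1%R]%classic).
have J0 t : 0 <= J t by rewrite /J indicE.
have mJ : measurable_fun setT J by exact: measurable_indic.
have E (h : R * R -> R) : bmeas h -> (forall z, 0 <= h z) ->
    I01 (fun s => I01 (fun t => h (s, t))) =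
    fine (\int[leb]_s \int[leb]_t (h (s, t) * J t * J s)%:E)%E.
  move=> bh h0; rewrite Rintegral_mkcond /Rintegral patch_indic.
  congr fine; apply: eq_integral => s _ /=.
  rewrite EFinM I01_ge0E// muleC.
  rewrite -ge0_integralZl//.
  - by apply: eq_integral => t _; rewrite -EFinM mulrC.
  - apply/measurable_EFinP; apply: measurable_funM.
      by case: (bmeas_sec1 s bh).
    exact: measurable_indic.
  - by move=> t _; rewrite lee_fin mulr_ge0.
apply: etrans (E _ bg g0) _.
apply: etrans _ (esym (E _ (bmeas_swap bg) (fun z => g0 _))).
have F := @fubini_tonelli _ _ _ _ R leb leb (fun z => (g z * J z.2 * J z.1)%:E).
congr fine; apply: etrans (F _ _) _.
- apply/measurable_EFinP; apply: measurable_funM; first apply: measurable_funM.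
  + by case: bg.
  + exact: (measurableT_comp mJ measurable_snd).
  + exact: (measurableT_comp mJ measurable_fst).
- by move=> z; rewrite lee_fin !mulr_ge0.
- by apply: eq_integral => t _; apply: eq_integral => s _; rewrite /= mulrAC.
Qed.

End UnitInterval.

Section CellIntegral.
Context {R : realType}.
Notation leb := (@lebesgue_measure R).
Notation I01 f := (Rintegral leb `[0%R, 1%R] f).

Lemma measurable_cons2 n :
  measurable_fun setT (fun z : R * n.-tuple R => [tuple of z.1 :: z.2]).
Proof. exact: measurable_cons. Qed.

Lemma bmeas_cons n (f : n.+1.-tuple R -> R) :
  bmeas f -> bmeas (fun z : R * n.-tuple R => f [tuple of z.1 :: z.2]).
Proof. by move=> bf; apply: (bmeas_comp bf); exact: measurable_cons2. Qed.

Lemma bmeas_cons_sec n (f : n.+1.-tuple R -> R) t :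
  bmeas f -> bmeas (fun y : n.-tuple R => f [tuple of t :: y]).
Proof. by move=> /bmeas_cons /(bmeas_sec1 t). Qed.

(** The parameter space is quantified inside the induction, which absorbs the first coordinate into
    it, replacing [T] by [T * R]. *)
Lemma bmeas_cell_int n : forall (d : measure_display) (T : measurableType d)
    (F : T * n.-tuple R -> R),
  bmeas F -> bmeas (fun x => cell_int (fun y => F (x, y))).
Proof.
elim: n => [|n IH] d T F bF /=.
  by apply: (bmeas_comp bF); exact: pair2_measurable.
pose G (z : (T * R) * n.-tuple R) := F (z.1.1, [tuple of z.1.2 :: z.2]).
have bG : bmeas G.
  apply: (bmeas_comp bF (h := fun z : (T * R) * n.-tuple R =>
    (z.1.1, [tuple of z.1.2 :: z.2]))).
  apply/measurable_fun_pairP; split => /=.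
    exact: (measurableT_comp measurable_fst measurable_fst).
  apply: measurable_cons => //.
  exact: (measurableT_comp measurable_snd measurable_fst).
exact: (bmeas_I01 (IH _ _ _ bG)).
Qed.

Lemma bmeas_cell_int_cons n (f : n.+1.-tuple R -> R) : bmeas f ->
  bmeas (fun t => cell_int (fun y : n.-tuple R => f [tuple of t :: y])).
Proof. by move=> /bmeas_cons /bmeas_cell_int. Qed.

Lemma cell_int_lin n a (f g : n.-tuple R -> R) : bmeas f -> bmeas g ->
  cell_int (fun x => a * f x + g x) = a * cell_int f + cell_int g.
Proof.
elim: n f g => [//|n IH] f g bf bg /=.
rewrite -I01_lin; [|exact: bmeas_cell_int_cons..].
by apply: eq_Rintegral => t _; rewrite IH//; exact: bmeas_cons_sec.
Qed.

Lemma eq_cell_int n (f g : n.-tuple R -> R) : f =1 g -> cell_int f = cell_int g.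
Proof. by move=> /funext ->. Qed.

Lemma cell_int_cst n (c : R) : cell_int (fun _ : n.-tuple R => c) = c.
Proof.
elim: n => [//|n IH] /=; rewrite -[RHS]I01_cst.
by apply: eq_Rintegral => t _; rewrite IH.
Qed.

Lemma cell_intZ n a (f : n.-tuple R -> R) : bmeas f ->
  cell_int (fun x => a * f x) = a * cell_int f.
Proof.
move=> bf; rewrite -[RHS]addr0 -[X in _ + X](cell_int_cst n) -cell_int_lin//.
  by apply: eq_cell_int => x; rewrite addr0.
exact: bmeas_cst.
Qed.

Lemma cell_intB n (f g : n.-tuple R -> R) : bmeas f -> bmeas g ->
  cell_int (fun x => f x - g x) = cell_int f - cell_int g.
Proof.
move=> bf bg; rewrite [RHS]addrC -mulN1r -cell_int_lin//.
by apply: eq_cell_int => x; rewrite mulN1r addrC.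
Qed.

Lemma cell_int_sum n (I : Type) (s : seq I) (a : I -> R)
    (f : I -> n.-tuple R -> R) : (forall i, bmeas (f i)) ->
  bmeas (fun x => \sum_(i <- s) a i * f i x) /\
  cell_int (fun x => \sum_(i <- s) a i * f i x) = \sum_(i <- s) a i * cell_int (f i).
Proof.
move=> bf; elim: s => [|i s [IHb IH]].
  rewrite (_ : (fun x : n.-tuple R => _) = fun=> 0).
    by rewrite big_nil cell_int_cst; split => //; exact: bmeas_cst.
  by apply/funext => x; rewrite big_nil.
rewrite (_ : (fun x : n.-tuple R => _) =
  fun x => a i * f i x + \sum_(i <- s) a i * f i x); last first.
  by apply/funext => x; rewrite big_cons.
split; first exact: bmeas_lin.
by rewrite big_cons cell_int_lin// IH.
Qed.

Lemma cell_int_le n (f g : n.-tuple R -> R) : bmeas f -> bmeas g ->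
  (forall x, f x <= g x) -> cell_int f <= cell_int g.
Proof.
elim: n f g => [|n IH] f g bf bg fg /=; first exact: fg.
apply: bmeas_le_Rintegral => //; first exact: lebesgue01_lty.
- exact: bmeas_cell_int_cons.
- exact: bmeas_cell_int_cons.
- by move=> t _; apply: IH => // *; exact: bmeas_cons_sec.
Qed.

Lemma cell_int_exchange n (F : R * n.-tuple R -> R) : bmeas F ->
  I01 (fun t => cell_int (fun y => F (t, y))) =
  cell_int (fun y => I01 (fun t => F (t, y))).
Proof.
elim: n F => [//|n IH] F bF /=.
pose G (z : (R * R) * n.-tuple R) := F (z.1.1, [tuple of z.1.2 :: z.2]).
have bG : bmeas G.
  apply: (bmeas_comp bF (h := fun z : (R * R) * n.-tuple R =>
    (z.1.1, [tuple of z.1.2 :: z.2]))).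
  apply/measurable_fun_pairP; split => /=.
    exact: (measurableT_comp measurable_fst measurable_fst).
  apply: measurable_cons => //.
  exact: (measurableT_comp measurable_snd measurable_fst).
rewrite (I01_exchange (bmeas_cell_int bG)).
apply: eq_Rintegral => s _.
rewrite (IH (fun z => F (z.1, [tuple of s :: z.2])))//.
apply: (bmeas_comp bG (h := fun z : R * n.-tuple R => ((z.1, s), z.2))).
apply/measurable_fun_pairP; split; last exact: measurable_snd.
by apply/measurable_fun_pairP; split; [exact: measurable_fst|exact: measurable_cst].
Qed.

Definition tset n (x : n.-tuple R) (i : 'I_n) (s : R) : n.-tuple R :=
  [tuple if j == i then s else tnth x j | j < n].

(** Fubini lets the [i]-th integration be carried out innermost. This reduces integration by parts
    on the torus to one variable. *)
Lemma cell_int_slice0 n (i : 'I_n) (f : n.-tuple R -> R) : bmeas f ->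
  (forall x, I01 (fun s => f (tset x i s)) = 0) -> cell_int f = 0.
Proof.
elim: n i f => [[]//|n IH] i f bf f0 /=.
case: (unliftP ord0 i) f0 => [j ->|->] f0.
  rewrite -[RHS]I01_cst; apply: eq_Rintegral => t _.
  apply: (IH j); first exact: bmeas_cons_sec.
  move=> y; rewrite -[RHS](f0 [tuple of t :: y]); apply: eq_Rintegral => s _.
  congr f; apply: eq_from_tnth => k.
  case: (unliftP ord0 k) => [k' ->|->].
    by rewrite tnthS !tnth_mktuple (inj_eq lift_inj) tnthS.
  by rewrite tnth0 tnth_mktuple -[_ == _]/false tnth0.
rewrite (cell_int_exchange (bmeas_cons bf)) -[RHS](cell_int_cst n).
apply: eq_cell_int => y; rewrite -[RHS](f0 [tuple of 0 :: y]).
apply: eq_Rintegral => s _; congr f; apply: eq_from_tnth => k.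
rewrite tnth_mktuple; case: (unliftP ord0 k) => [k' ->|->].
  by rewrite !tnthS.
by rewrite eqxx tnth0.
Qed.

End CellIntegral.

(** * Functions on the torus *)

Section TorusFunctions.
Context {R : realType} {d : nat}.
Notation periodic := Defs.periodic.
Implicit Types (f g : 'rV[R]_d -> R) (x y : 'rV[R]_d).

Lemma periodicD_int f x (z : 'I_d -> int) : periodic f ->
  f (x + \sum_i (z i)%:~R *: ebasis i) = f x.
Proof.
move=> pf.
have pfn i n y : f (y + n%:R *: ebasis i) = f y.
  elim: n y => [|n IH] y; first by rewrite scale0r addr0.
  by rewrite mulrS scalerDl scale1r [ebasis i + _]addrC addrA pf IH.
have pfz i (k : int) y : f (y + k%:~R *: ebasis i) = f y.
  case: k => n; first exact: pfn.
  by rewrite -[LHS](pfn i n.+1) -addrA -scalerDl NegzE mulrNz addNr scale0r addr0.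
rewrite -big_enum; elim: (enum _) x => [|i s IH] x; first by rewrite big_nil addr0.
by rewrite big_cons addrA IH pfz.
Qed.

Definition fracv x : 'rV[R]_d := \row_i (x 0 i - (Num.floor (x 0 i))%:~R).

Lemma fracv_itv x i : 0 <= fracv x 0 i < 1.
Proof.
rewrite mxE; have := floor_itv (x 0 i); rewrite intrD => /andP[? ?].
by apply/andP; split; lra.
Qed.

Lemma periodic_fracv f x : periodic f -> f (fracv x) = f x.
Proof.
move=> pf; rewrite -(periodicD_int (fracv x) (fun i => Num.floor (x 0 i)) pf).
congr f; apply/rowP => j; rewrite mxE summxE (bigD1 j)//= big1 => [|i ij].
  by rewrite !mxE !eqxx mulr1 addr0 subrK.
by rewrite !mxE eqxx eq_sym (negbTE ij) mulr0.
Qed.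

(** The closed cube is compact, unlike the half-open [cell], and still contains every representative
    [fracv x]. *)
Definition unit_cube : set 'rV[R]_d := [set v | forall i, 0 <= v 0 i <= 1].

Lemma compact_unit_cube : compact unit_cube.
Proof.
rewrite (_ : unit_cube = [set v | forall i, `[0, 1]%classic (v ord0 i)]).
  apply: (@rV_compact _ _ (fun=> `[0 : R, 1]%classic)) => i.
  exact: segment_compact.
by apply/seteqP; split=> v /= vi i; have := vi i; rewrite /= in_itv.
Qed.

Lemma fracv_unit_cube x : unit_cube (fracv x).
Proof. by move=> i; have /andP[-> /ltW ->] := fracv_itv x i. Qed.

Lemma contT_min f : contT f -> exists x0, forall x, f x0 <= f x.
Proof.
move=> [pf cf].
have [||c _ fc] := @EVT_min_rV _ _ f unit_cube _ compact_unit_cube.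
- by exists 0 => i; rewrite mxE lexx ler01.
- exact: continuous_subspaceT.
exists c => x; rewrite -(periodic_fracv x pf); apply: fc; rewrite inE.
exact: fracv_unit_cube.
Qed.

Lemma contT_cst c : contT (fun _ : 'rV[R]_d => c).
Proof. by split=> [//|]; exact: cst_continuous. Qed.

Lemma contT_lin a f g : contT f -> contT g -> contT (fun x => a * f x + g x).
Proof.
move=> [pf cf] [pg cg]; split=> [x i|x]; first by rewrite pf pg.
exact: (continuousD (continuousM (@cst_continuous _ _ a x) (cf x)) (cg x)).
Qed.

Lemma contTD f g : contT f -> contT g -> contT (fun x => f x + g x).
Proof.
move=> [pf cf] [pg cg]; split=> [x i|x]; first by rewrite pf pg.
exact: (continuousD (cf x) (cg x)).
Qed.

Lemma contTN f : contT f -> contT (fun x => - f x).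
Proof. by move=> [pf cf]; split=> [x i|x]; [rewrite pf|exact: (continuousN (cf x))]. Qed.

Lemma contTM f g : contT f -> contT g -> contT (fun x => f x * g x).
Proof.
move=> [pf cf] [pg cg]; split=> [x i|x]; first by rewrite pf pg.
exact: (continuousM (cf x) (cg x)).
Qed.

Lemma contT_norm f : contT f -> contT (fun x => `|f x|).
Proof.
move=> [pf cf]; split=> [x i|x]; first by rewrite pf.
exact: (continuous_comp (cf x) (@norm_continuous _ _ _)).
Qed.

Lemma contT_sum (I : Type) (s : seq I) (F : I -> 'rV[R]_d -> R) :
  (forall i, contT (F i)) -> contT (fun x => \sum_(i <- s) F i x).
Proof.
move=> cF; elim: s => [|i s IH].
  rewrite (_ : (fun _ => _) = fun=> 0); first exact: contT_cst.
  by apply/funext => x; rewrite big_nil.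
rewrite (_ : (fun _ => _) = fun x => F i x + \sum_(i <- s) F i x).
  exact: contTD.
by apply/funext => x; rewrite big_cons.
Qed.

Lemma contT_bounded f : contT f -> exists2 M, 0 <= M & forall x, `|f x| <= M.
Proof.
move=> /contT_norm /contTN /contT_min[x0 fx0].
by exists `|f x0| => // x; rewrite -lerN2; exact: fx0.
Qed.

Lemma unif_continuous_unit_cube f : continuous f -> forall e, 0 < e ->
  exists2 delta, 0 < delta & forall x y, unit_cube x ->
    (forall i, `|x 0 i - y 0 i| <= delta) -> `|f x - f y| <= e.
Proof.
move=> cf e e0.
pose P (r : R) x := forall y, (forall i, `|x 0 i - y 0 i| <= r) -> `|f x - f y| <= e.
have : \forall r \near 0^'+, unit_cube `<=` P r.
  have /compact_near_coveringP := compact_unit_cube; apply => x _.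
  have /cvgrPdist_le/(_ (e / 2)) := cf x; rewrite divr_gt0// => /(_ isT).
  move=> /nbhs_ballP[r /= r0 rf].
  (* Half of the radius moves the centre from [x] to [y], the other half leads from [y] to [z]. *)
  exists (ball x (r / 2), [set s | s < r / 2]).
    split => /=; first by apply: nbhsx_ballx; rewrite divr_gt0.
    by apply: nbhs_right_lt; rewrite divr_gt0.
  move=> [y s] /= [[_ xy] sr] z yz.
  have fy : `|f x - f y| <= e / 2.
    by apply: rf; split => // i j; apply: le_ball (xy i j); lra.
  have fz : `|f x - f z| <= e / 2.
    apply: rf; split => // i j; rewrite ord1.
    have := xy 0 j; rewrite /ball /= => xyj; have := yz j => yzj.
    rewrite -(subrKA (y 0 j)) (le_lt_trans (ler_normD _ _))//; lra.
  rewrite -(subrKA (f x)) (le_trans (ler_normD _ _))// distrC; lra.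
move=> PP.
have [r [r0 Pr]] := filter_ex (filterI (nbhs_right_gt (0 : R)) PP).
by exists r => // x y xc; exact: Pr.
Qed.

End TorusFunctions.

(** * Partial derivatives and conditions at a minimum *)

Section TorusDerivatives.
Context {R : realType} {d : nat}.
Notation periodic := Defs.periodic.
Implicit Types (f g phi : 'rV[R]_d -> R) (x y : 'rV[R]_d).

Definition line f x (v : 'rV[R]_d) : R -> R := fun s => f (x + s *: v).

(** Turns directional derivatives into ordinary ones along a line, where the mean value theorem and
    the fundamental theorem of calculus apply. *)
Lemma is_derive_line f x v s : derivable f (x + s *: v) v ->
  is_derive s 1 (line f x v) ('D_v f (x + s *: v)).
Proof.
set y := x + s *: v => df.
have E : (fun h : R => h^-1 *: ((line f x v \o shift s) (h *: 1) - line f x v s)) =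
         (fun h : R => h^-1 *: ((f \o shift y) (h *: v) - f y)).
  apply/funext => h; rewrite /line /= -/y; congr (_ *: (f _ - _)).
  by rewrite [h *: 1]mulr1 scalerDl /y addrCA addrA.
by apply: DeriveDef; rewrite /derivable /derive E.
Qed.

Lemma continuous_line f x v : continuous f -> continuous (line f x v).
Proof.
move=> cf s; apply: (@continuous_comp _ _ _ (fun s : R => x + s *: v) f); last exact: cf.
apply: continuousD; first exact: cst_continuous.
apply: cvgZr_tmp; exact: cvg_id.
Qed.

Lemma Ck_continuous k f : Ck k f -> continuous f.
Proof. by case: k => [|k] // []. Qed.

Lemma partial_lin i a f g : (forall x, derivable f x (ebasis i)) ->
  (forall x, derivable g x (ebasis i)) ->
  (forall x, derivable (fun y => a * f y + g y) x (ebasis i)) /\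
  partial i (fun y => a * f y + g y) = (fun y => a * partial i f y + partial i g y).
Proof.
move=> df dg.
have E : (fun y => a * f y + g y) = (a \*: f) + g by [].
split=> [x|]; first by rewrite E; apply: derivableD => //; exact: derivableZ.
apply/funext => x; rewrite /partial E deriveD//; last exact: derivableZ.
by rewrite deriveZ.
Qed.

Lemma Ck_lin k a f g : Ck k f -> Ck k g -> Ck k (fun x => a * f x + g x).
Proof.
have cont (u w : 'rV[R]_d -> R) : continuous u -> continuous w ->
    continuous (fun x => a * u x + w x).
  move=> cu cw x.
  exact: (continuousD (continuousM (@cst_continuous _ _ a x) (cu x)) (cw x)).
elim: k f g => [|k IH] f g /=; first exact: cont.
move=> [cf Df] [cg Dg]; split; first exact: cont.
move=> i; have [df Cf] := Df i; have [dg Cg] := Dg i.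
by have [dfg ->] := partial_lin a df dg; split => //; exact: IH.
Qed.

Lemma CkT_lin k a f g : CkT k f -> CkT k g -> CkT k (fun x => a * f x + g x).
Proof.
move=> [pf cf] [pg cg]; split; last exact: Ck_lin.
by move=> x i; rewrite pf pg.
Qed.

Lemma Ck_cst k c : Ck k (fun _ : 'rV[R]_d => c).
Proof.
elim: k c => [|k IH] c /=; first exact: cst_continuous.
split; [exact: cst_continuous|move=> i; split; first by move=> x; exact: derivable_cst].
by rewrite (_ : partial i _ = fun=> 0)//; apply/funext => x; exact: derive_cst.
Qed.

Lemma CkT_cst k c : CkT k (fun _ : 'rV[R]_d => c).
Proof. by split=> //; exact: Ck_cst. Qed.

Lemma periodic_partial f i : periodic f -> periodic (partial i f).
Proof.
move=> pf x j; rewrite /partial /derive.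
suff -> : (fun h : R => h^-1 *:
    ((f \o shift (x + ebasis j)) (h *: ebasis i) - f (x + ebasis j))) =
  (fun h : R => h^-1 *: ((f \o shift x) (h *: ebasis i) - f x)) by [].
by apply/funext => h /=; rewrite pf addrA pf.
Qed.

Lemma CkT_contT k f : CkT k f -> contT f.
Proof. by move=> [pf /Ck_continuous]. Qed.

Lemma CkT_partial k f i : CkT k.+1 f -> CkT k (partial i f).
Proof. by move=> [pf [_ /(_ i)[_ Cf]]]; split => //; exact: periodic_partial. Qed.

Lemma CkT_derivable k f i : CkT k.+1 f -> forall x, derivable f x (ebasis i).
Proof. by move=> [_ [_ /(_ i)[]]]. Qed.

Lemma partial_CkT_lin k i a f g : CkT k.+1 f -> CkT k.+1 g ->
  partial i (fun y => a * f y + g y) = (fun y => a * partial i f y + partial i g y).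
Proof.
move=> Cf Cg.
by have [] := @partial_lin i a f g (CkT_derivable Cf) (CkT_derivable Cg).
Qed.

Lemma grad_lin k a f g x : CkT k.+1 f -> CkT k.+1 g ->
  grad (fun y => a * f y + g y) x = a *: grad f x + grad g x.
Proof. by move=> Cf Cg; apply/rowP => i; rewrite !mxE (partial_CkT_lin _ _ Cf Cg). Qed.

Lemma laplacian_lin a f g x : CkT 2 f -> CkT 2 g ->
  laplacian (fun y => a * f y + g y) x = a * laplacian f x + laplacian g x.
Proof.
move=> Cf Cg; rewrite /laplacian mulr_sumr -big_split/=; apply: eq_bigr => i _.
by rewrite (partial_CkT_lin _ _ Cf Cg)
  (partial_CkT_lin _ _ (CkT_partial i Cf) (CkT_partial i Cg)).
Qed.

Lemma contT_laplacian f : CkT 2 f -> contT (laplacian f).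
Proof.
by move=> Cf; apply: contT_sum => i; apply: (@CkT_contT 0); do 2!apply: CkT_partial.
Qed.

Lemma contT_dotp_grad (A : 'rV[R]_d -> 'rV[R]_d) f :
  (forall j, CkT 2 (fun x => A x 0 j)) -> CkT 2 f ->
  contT (fun x => dotp (A x) (grad f x)).
Proof.
move=> CA Cf; apply: contT_sum => i.
rewrite (_ : (fun _ => _) = fun x => A x 0 i * partial i f x); last first.
  by apply/funext => x; rewrite mxE.
by apply: contTM; [exact: CkT_contT (CA i)|exact: CkT_contT (CkT_partial i Cf)].
Qed.

Lemma contT_comp_grad (H : 'rV[R]_d -> R) f : continuous H -> CkT 1 f ->
  contT (fun x => H (grad f x)).
Proof.
move=> cH Cf; split=> [x i|x].
  congr H; apply/rowP => j; rewrite !mxE.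
  by have [pf _] := Cf; rewrite periodic_partial.
apply: (@continuous_comp _ _ _ (grad f) H); last exact: cH.
suff cg : grad f y @[y --> x] --> grad f x by exact: cg.
apply/(@cvgrPdist_le _ _ _ _ (nbhs_filter x)) => /= e e0.
have : \forall y \near x, forall j, `|partial j f x - partial j f y| <= e.
  apply: (@filter_forall _ _ _ _ (nbhs_filter x)) => j.
  have [_ cf] := CkT_contT (CkT_partial j Cf).
  by have /cvgrPdist_le := cf x; apply.
apply: (@filterS _ _ (nbhs_filter x)) => y xy; rewrite [leLHS]mx_normrE.
apply/bigmax_leP; split; first exact: ltW.
by move=> [i j] _ /=; rewrite !mxE; exact: xy.
Qed.

(** If [c < 0], then [g1] is negative just to the right of 0, and the mean value theorem produces a
    value of [g] below [g 0]. *)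
Lemma second_derivative_test (g g1 : R -> R) (c : R) :
  (forall s : R, is_derive s 1 g (g1 s)) -> is_derive (0 : R) 1 g1 c ->
  (forall s, g 0 <= g s) -> g1 0 = 0 /\ 0 <= c.
Proof.
move=> dg dg1 gmin.
have g10 : g1 0 = 0.
  have : is_derive (0 : R) 1 g 0.
    apply: (@derive1_at_min _ g (-1) 1 0).
    - lra.
    - by move=> t _; exact: (@ex_derive _ _ _ _ _ _ _ (dg t)).
    - by rewrite in_itv /=; apply/andP; split; lra.
    - by move=> t _; exact: gmin.
  by move=> [_ d0]; have [_ d1] := dg 0; rewrite -d1 d0.
split => //; rewrite leNgt; apply/negP => c0.
have [dg1' cE] := dg1.
have : \forall h \near 0^', h^-1 *: (g1 (h *: 1 + 0) - g1 0) < 0.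
  have : h^-1 *: (g1 (h *: 1 + 0) - g1 0) @[h --> 0^'] --> c by rewrite -cE.
  by move=> /cvgr_lt; apply.
move=> /nbhs_ballP[r /= r0 rP].
have neg s : 0 < s -> s < r -> g1 s < 0.
  move=> s0 sr.
  have : s^-1 *: (g1 (s *: 1 + 0) - g1 0) < 0.
    apply: rP; last exact: lt0r_neq0.
    by rewrite /ball/= sub0r normrN gtr0_norm.
  by rewrite addr0 [s *: 1]mulr1 g10 subr0 pmulr_rlt0// invr_gt0.
have r2 : 0 < r / 2 by rewrite divr_gt0.
have [|s] := @MVT R g g1 0 (r / 2) r2 (fun t _ => dg t).
  apply: continuous_subspaceT => t.
  apply: differentiable_continuous; apply/derivable1_diffP.
  exact: (@ex_derive _ _ _ _ _ _ _ (dg t)).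
rewrite in_itv/= => /andP[s0 sr] /eqP; rewrite subr0 => gE.
have : g1 s * (r / 2) < 0 by rewrite pmulr_llt0// neg//; lra.
by rewrite -(eqP gE) subr_lt0 ltNge gmin.
Qed.

Lemma min_grad_laplacian f x0 : CkT 2 f -> (forall x, f x0 <= f x) ->
  grad f x0 = 0 /\ 0 <= laplacian f x0.
Proof.
move=> Cf fmin.
have H i : partial i f x0 = 0 /\ 0 <= partial i (partial i f) x0.
  have := @second_derivative_test (line f x0 (ebasis i))
    (line (partial i f) x0 (ebasis i)) (partial i (partial i f) x0).
  rewrite /line scale0r addr0; apply.
  - by move=> s; apply: is_derive_line; exact: (CkT_derivable Cf).
  - have := @is_derive_line (partial i f) x0 (ebasis i) 0.
    by rewrite scale0r addr0; apply; exact: (CkT_derivable (CkT_partial i Cf)).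
  - by move=> s; exact: fmin.
split; first by apply/rowP => i; rewrite !mxE; case: (H i).
by apply: sumr_ge0 => i _; case: (H i).
Qed.

End TorusDerivatives.

(** * Integration on the torus *)

Section Measurability.
Context {R : realType} {d : nat}.

(** Links the topology of row vectors with the product sigma-algebra of tuples: [f] is the pointwise
    limit of its values at the grid points of mesh [1 / n.+1] just below [x]. *)
Lemma continuous_row_of_tuple_measurable (f : 'rV[R]_d -> R) : continuous f ->
  measurable_fun setT (fun x : d.-tuple R => f (row_of_tuple x)).
Proof.
move=> cf.
pose q (n : nat) (z : {ffun 'I_d -> int}) : 'rV[R]_d :=
  \row_i ((z i)%:~R / n.+1%:R).
pose z (n : nat) (x : d.-tuple R) : {ffun 'I_d -> int} :=
  [ffun i => Num.floor (n.+1%:R * tnth x i)].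
apply: (@measurable_fun_cvg _ _ R setT
  (fun n (x : d.-tuple R) => f (q n (z n x)))); last first.
  move=> x _.
  suff qx : q n (z n x) @[n --> \oo] --> row_of_tuple x.
    exact: (continuous_cvg _ (cf _) qx).
  apply/cvgrPdist_le => e e0; near=> n.
  rewrite [leLHS]mx_normrE; apply/bigmax_leP; split; first exact: ltW.
  move=> [i j] _ /=; rewrite !mxE ffunE.
  have n0 : 0 < n.+1%:R :> R by rewrite ltr0n.
  have := floor_itv (n.+1%:R * tnth x j); rewrite intrD => /andP[h1 h2].
  rewrite -(ler_pM2l n0) -{1}(gtr0_norm n0) -normrM mulrBr mulrCA divff ?mulr1 ?gt_eqF//.
  rewrite ger0_norm ?subr_ge0//.
  have : e^-1 <= n.+1%:R.
    apply: (@le_trans _ _ n%:R); last by rewrite ler_nat.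
    by near: n; exact: nbhs_infty_ger.
  by rewrite -(ler_pM2l e0) divff ?gt_eqF// => ?; lra.
move=> n; move=> _ B mB; rewrite setTI.
(* The sampled function is constant on each of countably many boxes, so the first set of each
   intersection is everything or empty. *)
rewrite (_ : _ @^-1` B =
  \bigcup_w ([set x | B (f (q n w))] `&` (z n @^-1` [set w]))); last first.
  by apply/seteqP; split=> [x Bx|x [w _ [/= Bw zw]]]; [exists (z n x)|rewrite /= zw].
apply: countable_bigcupT_measurable => // w.
apply: measurableI.
  have [Bw|nBw] := pselect (B (f (q n w))).
    by rewrite (_ : mkset _ = setT)//; apply/seteqP; split.
  by rewrite (_ : mkset _ = set0)//; apply/seteqP; split.
have n0 : 0 < n.+1%:R :> R by rewrite ltr0n.
rewrite (_ : _ @^-1` _ = \bigcap_(i in [set: 'I_d])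
  ((fun x => tnth x i) @^-1` `[(w i)%:~R / n.+1%:R, (w i + 1)%:~R / n.+1%:R[%classic)).
  apply: fin_bigcap_measurable => // i _.
  by rewrite -[X in measurable X]setTI; apply: (measurable_tnth i).
apply/seteqP; split=> x /=.
  move=> zw i _ /=; rewrite in_itv /= -zw ffunE.
  have := floor_itv (n.+1%:R * tnth x i).
  by rewrite ler_pdivrMr// ltr_pdivlMr// ![_ * n.+1%:R]mulrC.
move=> h; apply/ffunP => i; rewrite ffunE; apply/floor_def.
have := h i Logic.I; rewrite /= in_itv/=.
by rewrite ler_pdivrMr// ltr_pdivlMr// ![_ * n.+1%:R]mulrC.
Unshelve. all: by end_near.
Qed.

End Measurability.

Section TorusIntegration.
Context {R : realType} {d : nat}.
Implicit Types (f g rho : 'rV[R]_d -> R) (eta : probability (d.-tuple R) R).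

Lemma bmeas_contT f : contT f -> bmeas (fun x : d.-tuple R => f (row_of_tuple x)).
Proof.
move=> cf; split; first by apply: continuous_row_of_tuple_measurable; case: cf.
have [M _ fM] := contT_bounded cf.
by apply/bounded_predP; exists M => x.
Qed.

Lemma torus_int_lin a f g : contT f -> contT g ->
  torus_int (fun x => a * f x + g x) = a * torus_int f + torus_int g.
Proof. by move=> cf cg; apply: cell_int_lin; exact: bmeas_contT. Qed.

Lemma torus_intB f g : contT f -> contT g ->
  torus_int (fun x => f x - g x) = torus_int f - torus_int g.
Proof. by move=> cf cg; apply: cell_intB; exact: bmeas_contT. Qed.

Lemma torus_intZ a f : contT f -> torus_int (fun x => a * f x) = a * torus_int f.
Proof. by move=> cf; apply: cell_intZ; exact: bmeas_contT. Qed.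

Lemma torus_int_cst (c : R) : torus_int (fun _ : 'rV[R]_d => c) = c.
Proof. exact: cell_int_cst. Qed.

Lemma torus_int_le f g : contT f -> contT g -> (forall x, f x <= g x) ->
  torus_int f <= torus_int g.
Proof. by move=> cf cg fg; apply: cell_int_le; [exact: bmeas_contT..|move=> x]. Qed.

Lemma torus_int_sum (I : Type) (s : seq I) (F : I -> 'rV[R]_d -> R) :
  (forall i, contT (F i)) ->
  torus_int (fun x => \sum_(i <- s) F i x) = \sum_(i <- s) torus_int (F i).
Proof.
move=> cF; have [_] := cell_int_sum s (fun=> 1) (fun i => bmeas_contT (cF i)).
under [RHS]eq_bigr do rewrite mul1r.
move=> <-; apply: eq_cell_int => x.
by under [RHS]eq_bigr do rewrite mul1r.
Qed.

(** Each slice is the integral of a derivative over one full period, whose end values agree by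
    periodicity. *)
Lemma torus_int_partial f i : contT f -> (forall x, derivable f x (ebasis i)) ->
  contT (partial i f) -> torus_int (partial i f) = 0.
Proof.
move=> [pf cf] df cD; apply: (cell_int_slice0 (i := i)); first exact: bmeas_contT.
move=> x; set y := row_of_tuple (tset x i 0).
have rowE s : row_of_tuple (tset x i s) = y + s *: ebasis i.
  apply/rowP => j; rewrite !mxE !tnth_mktuple; rewrite eqxx/=.
  by case: (eqVneq j i) => _; rewrite ?mulr1 ?add0r ?mulr0 ?addr0.
under eq_Rintegral do rewrite rowE.
have cl : continuous (line f y (ebasis i)) by exact: continuous_line.
rewrite /Rintegral (@continuous_FTC2 _ _ (line f y (ebasis i))) ?ltr01//.
- by rewrite /line scale1r scale0r addr0 pf -EFinB subrr.
- by apply: continuous_subspaceT; apply: continuous_line; case: cD.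
- split.
  + by move=> s _; exact: (@ex_derive _ _ _ _ _ _ _ (is_derive_line (df _))).
  + exact: cvg_at_right_filter (cl 0).
  + exact: cvg_at_left_filter (cl 1).
- move=> s _; rewrite derive1E.
  by have [_ ->] := is_derive_line (df (y + s *: ebasis i)).
Qed.

Lemma torus_int_laplacian0 f : CkT 2 f -> torus_int (laplacian f) = 0.
Proof.
move=> Cf; rewrite torus_int_sum => [|i]; last first.
  by apply: (@CkT_contT _ _ 0); do 2!apply: CkT_partial.
rewrite big1// => i _; apply: torus_int_partial.
- exact: CkT_contT (CkT_partial i Cf).
- exact: (CkT_derivable (CkT_partial i Cf)).
- exact: CkT_contT (CkT_partial i (CkT_partial i Cf)).
Qed.

(** The difference of the integrands is the divergence of [g grad f - f grad g]: the products of
    first derivatives cancel. *)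
Lemma torus_int_green f g : CkT 2 f -> CkT 2 g ->
  torus_int (fun x => laplacian f x * g x) = torus_int (fun x => f x * laplacian g x).
Proof.
move=> Cf Cg; apply/eqP; rewrite -subr_eq0 -torus_intB; last 2 first.
- by apply: contTM; [exact: contT_laplacian|exact: CkT_contT Cg].
- by apply: contTM; [exact: CkT_contT Cf|exact: contT_laplacian].
pose h i x := partial i f x * g x - f x * partial i g x.
pose D i x := partial i (partial i f) x * g x - f x * partial i (partial i g) x.
have cf := CkT_contT Cf; have cg := CkT_contT Cg.
have cpf i := CkT_contT (CkT_partial i Cf).
have cpg i := CkT_contT (CkT_partial i Cg).
have cppf i := CkT_contT (CkT_partial i (CkT_partial i Cf)).
have cppg i := CkT_contT (CkT_partial i (CkT_partial i Cg)).
have cD i : contT (D i) by apply: contTD; [exact: contTM|apply: contTN; exact: contTM].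
have dh i x : is_derive x (ebasis i) (h i) (D i x).
  have df : derivable f x (ebasis i) by exact: (CkT_derivable Cf).
  have dg : derivable g x (ebasis i) by exact: (CkT_derivable Cg).
  have dpf : derivable (partial i f) x (ebasis i).
    exact: (CkT_derivable (CkT_partial i Cf)).
  have dpg : derivable (partial i g) x (ebasis i).
    exact: (CkT_derivable (CkT_partial i Cg)).
  have E : h i = (partial i f * g) - (f * partial i g) by [].
  have d1 := derivableM dpf dg; have d2 := derivableM df dpg.
  rewrite E; apply: DeriveDef; first exact: (derivableB d1 d2).
  rewrite (deriveB d1 d2) (deriveM dpf dg) (deriveM df dpg).
  have alg (a b c e u v : R) : a * b + c * e - (u * v + b * a) = e * c - u * v.
    by ring.
  exact: alg.
rewrite (_ : (fun _ => _) = fun x => \sum_i D i x); last first.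
  apply/funext => x; rewrite /laplacian mulr_suml mulr_sumr -sumrB.
  by apply: eq_bigr.
rewrite torus_int_sum// big1// => i _.
have DE : D i = partial i (h i).
  by apply/funext => x; have [_ <-] := dh i x.
rewrite DE; apply: torus_int_partial; last by rewrite -DE.
  by apply: contTD; [exact: contTM|apply: contTN; exact: contTM].
by move=> x; case: (dh i x).
Qed.

End TorusIntegration.

(* [f] is within [e] of a simple function taking multiples of [e]. *)
Lemma bmeas_functional_eq0 (R : realType) {disp : measure_display} {T : measurableType disp}
    (J : (T -> R) -> R) (K : R) :
  (forall a f g, bmeas f -> bmeas g -> J (fun x => a * f x + g x) = a * J f + J g) ->
  (forall f e, bmeas f -> (forall x, `|f x| <= e) -> `|J f| <= K * e) ->
  (forall B : set T, measurable B -> J \1_B = 0) ->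
  forall f, bmeas f -> J f = 0.
Proof.
move=> Jlin JK J1 f bf; have [mf /bounded_predP[M fM]] := bf.
have J0 : J (fun=> 0) = 0.
  have := Jlin (-1) _ _ (bmeas_cst 0) (bmeas_cst 0).
  have -> : (fun x : T => -1 * 0 + 0) = (fun=> 0 : R).
    by apply/funext => x; rewrite mulr0 addr0.
  lra.
have Je e : 0 < e -> `|J f| <= K * e.
  move=> e0.
  pose B (k : nat) := [set x | k%:R * e <= f x + M < k.+1%:R * e].
  have mB k : measurable (B k).
    rewrite (_ : B k = f @^-1` `[k%:R * e - M, k.+1%:R * e - M[%classic).
      by rewrite -[X in measurable X]setTI; exact: mf.
    by apply/seteqP; split=> x; rewrite /B /= in_itv/= lerBlDr ltrBrDr.
  (* [f + M] takes values in [0, 2M], so [N] levels of height [e] cover its range. *)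
  pose N := (Num.truncn (2 * M / e)).+1.
  pose c (k : nat) := k%:R * e - M.
  pose S x := \sum_(k <- iota 0 N) c k * \1_(B k) x.
  have [bS JS] : bmeas S /\ J S = 0.
    rewrite /S; elim: (iota 0 N) => [|k s [IHb IH]].
      rewrite (_ : (fun x : T => _) = fun=> 0).
        by split => //; exact: bmeas_cst.
      by apply/funext => x; rewrite big_nil.
    rewrite (_ : (fun x : T => _) =
      fun x => c k * \1_(B k) x + \sum_(k <- s) c k * \1_(B k) x); last first.
      by apply/funext => x; rewrite big_cons.
    have b1 := bmeas_indic (R := R) (mB k).
    split; first exact: bmeas_lin.
    by rewrite Jlin// IH J1// mulr0 addr0.
  have SE x : `|f x - S x| <= e.
    have fM0 : 0 <= f x + M <= 2 * M.
      by have := fM x; rewrite ler_norml => /andP[? ?]; apply/andP; split; lra.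
    have /andP[fM1 fM2] := fM0.
    have q0 : 0 <= (f x + M) / e by rewrite divr_ge0// ltW.
    pose k := Num.truncn ((f x + M) / e).
    have kB : B k x.
      by have := truncn_itv q0; rewrite ler_pdivlMr// ltr_pdivrMr.
    have uk j : B j x -> j = k.
      rewrite /B/= => xj; apply/esym/truncn_def.
      by rewrite ler_pdivlMr// ltr_pdivrMr.
    have kN : (k < N)%N.
      rewrite ltnS; apply: le_truncn.
      by rewrite ler_pM2r ?invr_gt0.
    have -> : S x = c k.
      rewrite /S (bigD1_seq k) ?iota_uniq ?mem_iota//= big1 ?addr0 => [|j jk].
        by rewrite indicE mem_set// mulr1.
      rewrite indicE memNset ?mulr0// => /uk jk'.
      by rewrite jk' eqxx in jk.
    move: kB; rewrite /B/= /c => /andP[h1 h2].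
    rewrite -natr1 in h2.
    by rewrite ger0_norm; lra.
  have -> : J f = J (fun x => -1 * S x + f x) by rewrite Jlin// JS mulr0 add0r.
  apply: JK; first exact: bmeas_lin.
  by move=> x; rewrite addrC mulN1r.
apply/eqP; rewrite -normr_eq0 eq_le normr_ge0 andbT leNgt; apply/negP => Jf0.
have [K0|K0] := leP K 0.
  have := Je _ ltr01; rewrite mulr1 => ?; lra.
(* This choice of [e] makes the bound [K * e] half of [J f] in absolute value, a contradiction. *)
have := Je (`|J f| / (2 * K)) _; rewrite divr_gt0 ?mulr_gt0// => /(_ isT).
have -> : K * (`|J f| / (2 * K)) = `|J f| / 2.
  by field; rewrite gt_eqF.
lra.
Qed.

(** * Integration against a probability measure and its density *)

Section Density.
Context {R : realType} {d : nat}.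
Implicit Types (f g rho : 'rV[R]_d -> R) (eta : probability (d.-tuple R) R).

Lemma meas_intE eta f :
  meas_int eta f = Rintegral eta setT (fun x => f (row_of_tuple x)).
Proof. by []. Qed.

Lemma prob_lty eta : (eta setT < +oo)%E.
Proof. by rewrite probability_setT ltry. Qed.

Lemma meas_int_lin eta a f g : contT f -> contT g ->
  meas_int eta (fun x => a * f x + g x) = a * meas_int eta f + meas_int eta g.
Proof.
move=> cf cg; rewrite !meas_intE.
exact: (bmeas_Rintegral_lin (mu := eta) measurableT (prob_lty eta)
  _ (bmeas_contT cf) (bmeas_contT cg)).
Qed.

Lemma Rintegral_prob_cst {disp : measure_display} {T : measurableType disp}
  (P : probability T R) (c : R) : Rintegral P setT (fun=> c) = c.
Proof. by rewrite Rintegral_cst// [X in fine X]probability_setT mulr1. Qed.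

Lemma meas_int_cst eta c : meas_int eta (fun=> c) = c.
Proof. by rewrite meas_intE Rintegral_prob_cst. Qed.

Lemma meas_int_le eta f g : contT f -> contT g -> (forall x, f x <= g x) ->
  meas_int eta f <= meas_int eta g.
Proof.
move=> cf cg fg; rewrite !meas_intE.
exact: (bmeas_le_Rintegral (mu := eta) measurableT (prob_lty eta)
  (bmeas_contT cf) (bmeas_contT cg)).
Qed.

(** [has_density] speaks of indicators only. The difference of the two integrals vanishes on them
    and is bounded by [1 + C] times the sup norm: 1 is the mass of [eta] and [C] bounds [rho]. *)
Lemma meas_int_density eta rho f : has_density eta rho -> contT rho ->
  contT f -> meas_int eta f = torus_int (fun x => f x * rho x).
Proof.
move=> hd crho cf.
have [C C0 rhoC] := contT_bounded crho.
have brho := bmeas_contT crho.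
pose r (x : d.-tuple R) := rho (row_of_tuple x).
pose J (F : d.-tuple R -> R) :=
  Rintegral eta setT F - cell_int (fun x => F x * r x).
suff : J (fun x => f (row_of_tuple x)) = 0.
  by move/eqP; rewrite subr_eq0 => /eqP.
apply: (bmeas_functional_eq0 (J := J) (K := 1 + C)); last exact: bmeas_contT.
- move=> a F G bF bG; rewrite /J.
  rewrite (bmeas_Rintegral_lin (mu := eta) measurableT (prob_lty eta))//.
  have -> : (fun x => (a * F x + G x) * r x) = fun x => a * (F x * r x) + G x * r x.
    by apply/funext => x; rewrite mulrDl mulrA.
  by rewrite cell_int_lin; [ring|exact: bmeasM..].
- move=> F e bF Fe.
  have h1 : `|Rintegral eta setT F| <= e.
    rewrite ler_norml -{1}[- e](Rintegral_prob_cst eta) -{2}[e](Rintegral_prob_cst eta).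
    apply/andP; split; apply: bmeas_le_Rintegral => //; try exact: bmeas_cst;
      try exact: prob_lty.
      by move=> x _; have := Fe x; rewrite ler_norml => /andP[].
    by move=> x _; have := Fe x; rewrite ler_norml => /andP[].
  have e0 : 0 <= e by apply: le_trans (Fe [tuple of nseq d 0]).
  have h2 : `|cell_int (fun x => F x * r x)| <= e * C.
    have Frb x : `|F x * r x| <= e * C.
      by rewrite normrM ler_pM//; exact: rhoC.
    rewrite ler_norml -{1}[- _](cell_int_cst d) -{2}[e * C](cell_int_cst d).
    apply/andP; split; apply: cell_int_le; try exact: bmeas_cst; try exact: bmeasM.
      by move=> x; have := Frb x; rewrite ler_norml => /andP[].
    by move=> x; have := Frb x; rewrite ler_norml => /andP[].
  rewrite (le_trans (ler_normB _ _))// mulrDl mul1r lerD//.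
  by rewrite mulrC.
- move=> B mB; rewrite /J /Rintegral.
  have -> : (\int[eta]_x (\1_B x)%:E)%E = eta B by rewrite integral_indic// setIT.
  by rewrite (hd _ mB) subrr.
Qed.

End Density.

(** * Representation of a mean by a probability measure *)

Section Walk.
Context {R : realType} {T : Type}.
Variables (L : (T -> R) -> R) (S : nat -> T -> bool).
Hypothesis Lmean : is_mean L.
Notation leb := (@lebesgue_measure R).

Definition mass (Q : T -> bool) : R := L (fun x => (Q x)%:R).

(** Invariant: [Q] is the set of points compatible with the bits read so far, and it owns the
    interval [[a, a + mass Q[] containing [t]. The part of [Q] outside [S k] takes the left piece,
    the part inside takes the right one. *)
Fixpoint walk n k (Q : T -> bool) (a t : R) : seq bool :=
  if n is n'.+1 then
    let b := a + mass (fun x => Q x && ~~ S k x) in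
    if b <= t then true :: walk n' k.+1 (fun x => Q x && S k x) b t
    else false :: walk n' k.+1 (fun x => Q x && ~~ S k x) a t
  else [::].

Definition bits n k x := [seq S j x | j <- iota k n].

Lemma size_walk n k Q a t : size (walk n k Q a t) = n.
Proof. by elim: n k Q a => //= n IH k Q a; case: ifP => _ /=; rewrite IH. Qed.

Lemma take_walk n m k Q a t : take n (walk (n + m) k Q a t) = walk n k Q a t.
Proof.
elim: n k Q a => [|n IH] k Q a /=; first by rewrite take0.
by case: ifP => _ /=; rewrite IH.
Qed.

Lemma bounded_pred_cst (c : R) : (fun _ : T => c) \in bounded_pred.
Proof. by apply/bounded_predP; exists `|c|. Qed.

Lemma bounded_pred_bool (Q : T -> bool) : (fun x => (Q x)%:R : R) \in bounded_pred.
Proof.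
by apply/bounded_predP; exists 1 => x; case: (Q x); rewrite ?normr1 ?normr0.
Qed.

Lemma bounded_predM (f g : T -> R) : f \in bounded_pred -> g \in bounded_pred ->
  (fun x => f x * g x) \in bounded_pred.
Proof.
move=> /bounded_predP[M fM] /bounded_predP[N gN].
by apply/bounded_predP; exists (M * N) => x; rewrite normrM ler_pM.
Qed.

Lemma bounded_pred_bits n k (g : seq bool -> R) :
  (fun x => g (bits n k x)) \in bounded_pred.
Proof.
elim: n k g => [|n IH] k g; first exact: (bounded_pred_cst (g [::])).
have /bounded_predP[M hM] := IH k.+1 (fun s => g (true :: s)).
have /bounded_predP[N hN] := IH k.+1 (fun s => g (false :: s)).
apply/bounded_predP; exists (M + N) => x; rewrite /bits /= -/(bits n k.+1 x).
have := hM x; have := hN x.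
have := normr_ge0 (g (true :: bits n k.+1 x)).
have := normr_ge0 (g (false :: bits n k.+1 x)).
by case: (S k x); lra.
Qed.

Lemma mean0 : L (fun=> 0) = 0.
Proof.
have := Lmean.1 (-1) _ _ (bounded_pred_cst 0) (bounded_pred_cst 0).
have -> : (fun x : T => -1 * 0 + 0) = (fun=> 0 : R).
  by apply/funext => x; rewrite mulr0 addr0.
lra.
Qed.

Lemma meanD f g : f \in bounded_pred -> g \in bounded_pred ->
  L (fun x => f x + g x) = L f + L g.
Proof.
move=> bf bg; rewrite -[L f]mul1r -Lmean.1//; congr L.
by apply/funext => x; rewrite mul1r.
Qed.

Lemma meanZ a f : f \in bounded_pred -> L (fun x => a * f x) = a * L f.
Proof.
move=> bf; rewrite -[RHS]addr0 -[X in _ + X]mean0 -Lmean.1//.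
  by congr L; apply/funext => x; rewrite addr0.
exact: bounded_pred_cst.
Qed.

Lemma mean_cst c : L (fun=> c) = c.
Proof.
have le e : L (fun=> e) <= e by apply: Lmean.2 => //; exact: bounded_pred_cst.
apply/eqP; rewrite eq_le le/= -lerN2 -mulN1r -meanZ; last exact: bounded_pred_cst.
by rewrite (_ : (fun=> _) = fun=> - c)//; apply/funext => x; rewrite mulN1r.
Qed.

Lemma mean_ge0 f : f \in bounded_pred -> (forall x, 0 <= f x) -> 0 <= L f.
Proof.
move=> bf f0; rewrite -oppr_le0 -mulN1r -meanZ//; apply: Lmean.2.
  by apply: bounded_predM => //; exact: bounded_pred_cst.
by move=> x; rewrite mulN1r oppr_le0.
Qed.

Lemma mass_ge0 Q : 0 <= mass Q.
Proof. by apply: mean_ge0 => //; exact: bounded_pred_bool. Qed.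

Lemma mass_split Q k :
  mass Q = mass (fun x => Q x && ~~ S k x) + mass (fun x => Q x && S k x).
Proof.
rewrite /mass -meanD; [|exact: bounded_pred_bool..].
by congr L; apply/funext => x; case: (Q x); case: (S k x); rewrite /= ?addr0 ?add0r.
Qed.

Lemma bmeas_walk n k Q a (g : seq bool -> R) :
  bmeas (fun t : R => g (walk n k Q a t)).
Proof.
elim: n k Q a g => [|n IH] k Q a g /=; first exact: bmeas_cst.
set b := a + _.
pose u t := g (true :: walk n k.+1 (fun x => Q x && S k x) b t).
pose v t := g (false :: walk n k.+1 (fun x => Q x && ~~ S k x) a t).
have bu : bmeas u by exact: (IH _ _ _ (fun s => g (true :: s))).
have bv : bmeas v by exact: (IH _ _ _ (fun s => g (false :: s))).
have b1 := bmeas_indic (R := R) (measurable_itv `[b, +oo[).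
have b2 := bmeas_indic (R := R) (measurable_itv `]-oo, b[).
rewrite (_ : (fun t => _) = fun t => \1_(`[b, +oo[%classic) t * u t +
  \1_(`]-oo, b[%classic) t * v t).
  by apply: bmeasD; exact: bmeasM.
apply/funext => t; rewrite !indicE !mem_setE !in_itv/= andbT.
by rewrite (ltNge t b); case: ifP => bt; rewrite /= ?mul1r ?mul0r ?addr0 ?add0r.
Qed.

(** The word read by a uniform [t] is distributed as [bits] under [L]. Lengths of intervals are
    masses by construction, and finite additivity is enough for words of finite length. *)
Lemma integral_walk n k Q a (g : seq bool -> R) :
  Rintegral leb `[a, a + mass Q[ (fun t => g (walk n k Q a t)) =
  L (fun x => (Q x)%:R * g (bits n k x)).
Proof.
elim: n k Q a g => [|n IH] k Q a g.
  rewrite /= Rintegral_cst// mulrC [RHS](_ : _ = L (fun x => g [::] * (Q x)%:R)).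
    rewrite meanZ; last exact: bounded_pred_bool.
    rewrite -/(mass Q) mulrC; congr (_ * _).
    rewrite [X in fine X]lebesgue_measure_itv/= lte_fin.
    have := mass_ge0 Q; rewrite le_eqVlt => /predU1P[<-|m0].
      by rewrite addr0 ltxx.
    by rewrite ltrDl m0/= addrC addKr.
  by congr L; apply/funext => x; rewrite mulrC.
rewrite /=; set b := a + mass (fun x => Q x && ~~ S k x).
have bE : a + mass Q = b + mass (fun x => Q x && S k x).
  by rewrite (mass_split Q k) addrA.
have ab : a <= b by rewrite lerDl mass_ge0.
have bc : b <= a + mass Q by rewrite bE lerDl mass_ge0.
have -> : `[a, a + mass Q[%classic = `[a, b[%classic `|` `[b, a + mass Q[%classic.
  by rewrite -itv_bndbnd_setU// bnd_simp.
rewrite Rintegral_setU//.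
- rewrite [RHS](_ : _ =
    L (fun x => (Q x && ~~ S k x)%:R * g (false :: bits n k.+1 x)) +
    L (fun x => (Q x && S k x)%:R * g (true :: bits n k.+1 x))).
    congr (_ + _).
      rewrite -(IH _ _ a (fun s => g (false :: s))); apply: eq_Rintegral => t.
      by rewrite inE/= in_itv/= => /andP[_ tb]; rewrite leNgt tb.
    rewrite -(IH _ _ b (fun s => g (true :: s))) bE; apply: eq_Rintegral => t.
    by rewrite inE/= in_itv/= => /andP[-> _].
  rewrite -meanD.
  + congr L; apply/funext => x; rewrite /bits /=.
    by case: (Q x); case: (S k x); rewrite /= ?mul0r ?addr0 ?add0r.
  + apply: bounded_predM; first exact: bounded_pred_bool.
    exact: (bounded_pred_bits n k.+1 (fun s => g (false :: s))).
  + apply: bounded_predM; first exact: bounded_pred_bool.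
    exact: (bounded_pred_bits n k.+1 (fun s => g (true :: s))).
- apply: bmeas_integrable; last exact: (bmeas_walk n.+1).
    by apply: measurableU.
  rewrite -itv_bndbnd_setU ?bnd_simp//.
  by rewrite [ltLHS]lebesgue_measure_itv/=; case: ifP; rewrite ?ltry// -EFinB ltry.
- apply/disj_setPS => t [] /=.
  by rewrite !in_itv/= => /andP[_ tb] /andP[bt _]; move: bt; rewrite leNgt tb.
Qed.

(** An interval containing [t] has positive length, and a set of positive mass has a point. *)
Lemma walk_witness n k Q (a t : R) : a <= t < a + mass Q ->
  exists2 x, Q x & bits n k x = walk n k Q a t.
Proof.
elim: n k Q a => [|n IH] k Q a /= /andP[h1 h2].
  have [//|nQ] := pselect (exists2 x, Q x & @nil bool = [::]).
  suff : mass Q <= 0 by move=> ?; exfalso; lra.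
  apply: Lmean.2; first exact: bounded_pred_bool.
  by move=> x; case: (boolP (Q x)) => // Qx; exfalso; apply: nQ; exists x.
case: ifPn => [bt|]; last rewrite -ltNge => tb.
  have [|x /andP[Qx Sx] xE] := IH k.+1 (fun x => Q x && S k x)
    (a + mass (fun x => Q x && ~~ S k x)).
    by rewrite bt -addrA -mass_split.
  by exists x => //; rewrite /bits /= Sx -xE.
have [|x /andP[Qx nSx] xE] := IH k.+1 (fun x => Q x && ~~ S k x) a.
  by rewrite h1.
by exists x => //; rewrite /bits /= (negbTE nSx) -xE.
Qed.

End Walk.

Section MeanRepresentation.
Context {R : realType} {d : nat} {T : Type}.
Variables (L : (T -> R) -> R) (c : T -> 'rV[R]_d).
Hypothesis Lmean : is_mean L.
Hypothesis c01 : forall x i, 0 <= c x 0 i < 1.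
Notation leb := (@lebesgue_measure R).

(** Enumerates the half-spaces with rational threshold through [pickle]; numbers that code no pair
    give the empty set. *)
Definition halfspace (k : nat) (x : T) : bool :=
  if unpickle k is Some iq then
    let: (i, q) := iq : 'I_d * rat in c x 0 i < ratr q
  else false.

(** Once [n] exceeds the codes of all thresholds [j / N], equal bits place every coordinate of both
    points in the same interval of length [1 / N <= e]. *)
Lemma bits_diam e : 0 < e -> exists n0, forall n x y, (n0 <= n)%N ->
  bits halfspace n 0 x = bits halfspace n 0 y ->
  forall i, `|c x 0 i - c y 0 i| <= e.
Proof.
move=> e0.
pose N := (Num.truncn e^-1).+1.
have N0 : 0 < N%:R :> R by rewrite ltr0n.
have Ne : N%:R^-1 <= e.
  have e1 : 0 < e^-1 by rewrite invr_gt0.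
  have /andP[_ eN] := truncn_itv (ltW e1).
  by rewrite -[leRHS]invrK lef_pV2 ?posrE// ltW.
(* The index runs up to [N] included: the threshold used below is [j.+1 / N] with [j < N]. *)
pose code (i : 'I_d) (j : 'I_N.+1) : nat := pickle (i, (j%:R / N%:R : rat)).
exists (\max_i \max_j code i j).+1 => n x y n0n xy i.
suff H u v : bits halfspace n 0 u = bits halfspace n 0 v ->
    c u 0 i - c v 0 i <= e.
  by rewrite ler_norml; have := H _ _ xy; have := H _ _ (esym xy) => ? ?;
    apply/andP; split; lra.
move=> uv.
have uvk k : (k < n)%N -> halfspace k u = halfspace k v.
  move=> kn; have := congr1 (fun s => nth false s k) uv.
  by rewrite !(nth_map 0%N) ?size_iota// nth_iota// add0n.
have /andP[v0 v1] := c01 v i.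
have q0 : 0 <= N%:R * c v 0 i by rewrite mulr_ge0// ltW.
have := truncn_itv q0; set j := Num.truncn _ => /andP[j1 j2].
have jN : (j.+1 < N.+1)%N.
  rewrite ltnS -(ltr_nat R) (le_lt_trans j1)// gtr_pMr//.
have := uvk (code i (Ordinal jN)).
have -> : (code i (Ordinal jN) < n)%N.
  apply: leq_trans n0n; rewrite ltnS.
  apply: leq_trans (leq_bigmax_cond (F := fun i => \max_j code i j) _ (erefl : xpredT i)).
  exact: (leq_bigmax_cond (F := code i)).
move=> /(_ isT); rewrite /halfspace /code pickleK /=.
have -> : ratr (j.+1%:R / N%:R) = j.+1%:R / N%:R :> R.
  by rewrite rmorph_div /= ?ratr_nat// unitfE pnatr_eq0.
have -> : c v 0 i < j.+1%:R / N%:R by rewrite ltr_pdivlMr// mulrC.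
move=> cu.
have h1 : j%:R / N%:R <= c v 0 i by rewrite ler_pdivrMr// mulrC.
move: cu; rewrite -natr1 mulrDl mul1r => cu; lra.
Qed.

(** Points realising longer and longer words of [t] form a Cauchy sequence, uniformly in [t], with
    limit [Y t]. Replacing both [Y t] and [c x] by representatives of their [n]-bit words costs at
    most [e / 2] on each side, and [integral_walk] identifies what remains. *)
Lemma mean_limit : exists Y : R -> 'rV[R]_d,
  [/\ forall i, measurable_fun setT (fun t => Y t 0 i),
      forall t, unit_cube (Y t) &
      forall f, contT f -> bmeas (fun t => f (Y t)) ->
        Rintegral leb `[0, 1] (fun t => f (Y t)) = L (fun x => f (c x))].
Proof.
pose W n t := walk L halfspace n 0 xpredT 0 t.
have mass1 : mass L xpredT = 1 by exact: mean_cst.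
have wit n t : 0 <= t < 1 -> exists x, bits halfspace n 0 x = W n t.
  move=> t01; have [|x _ xE] := @walk_witness R T L halfspace Lmean n 0 xpredT 0 t.
    by rewrite add0r mass1.
  by exists x.
have [x0 _] : exists x : T, bits halfspace 0 0 x = W 0 0.
  by apply: wit; rewrite lexx ltr01.
(* [z w] realises the word [w] whenever some point does; its value is arbitrary otherwise. *)
have /choice[z zP] (w : seq bool) : exists x, (exists y, bits halfspace (size w) 0 y = w) ->
    bits halfspace (size w) 0 x = w.
  have [[y yw]|n] := pselect (exists y, bits halfspace (size w) 0 y = w).
    by exists y.
  by exists x0.
pose p n t := c (z (W n t)).
have bitsz n t : 0 <= t < 1 -> bits halfspace n 0 (z (W n t)) = W n t.
  move=> t01; have sW : size (W n t) = n by exact: size_walk.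
  by have := zP (W n t); rewrite sW; apply; exact: wit.
have pcauchy e : 0 < e -> exists n0, forall n m t i, 0 <= t < 1 -> (n0 <= n)%N ->
    `|p (n + m)%N t 0 i - p n t 0 i| <= e.
  move=> e0; have [n0 H] := bits_diam e0.
  exists n0 => n m t i t01 n0n; apply: (H n) => //.
  have takeE x : bits halfspace n 0 x = take n (bits halfspace (n + m) 0 x).
    by rewrite /bits -map_take take_iota (minn_idPl (leq_addr _ _)).
  by rewrite [LHS]takeE !bitsz//; exact: take_walk.
(* Outside [0, 1[ the words need not be realised; the indicator makes the sequence converge for
   every [t]. *)
pose X n t i := p n t 0 i * \1_(`[0, 1[%classic) t.
have XE n t i : 0 <= t < 1 -> X n t i = p n t 0 i.
  by move=> t01; rewrite /X indicE mem_set ?mulr1//= in_itv.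
have X0 n t i : ~~ (0 <= t < 1) -> X n t i = 0.
  by move=> t01; rewrite /X indicE memNset ?mulr0//= in_itv/= (negbTE t01).
have Xcvg t i : cvgn (fun n => X n t i).
  have [t01|t01] := boolP (0 <= t < 1); last first.
    rewrite (_ : (fun n => _) = fun=> 0); first exact: is_cvg_cst.
    by apply/funext => n; rewrite X0.
  apply: cauchy_cvg; apply: cauchy_exP => e e0.
  have [n0 H] := pcauchy (e / 2) ltac:(by rewrite divr_gt0).
  exists (X n0 t i); exists n0 => // n /= n0n.
  rewrite -ball_normE /ball_ /= !XE// -(subnKC n0n) distrC.
  by rewrite (le_lt_trans (H _ _ _ _ t01 (leqnn _)))//; lra.
pose Y t : 'rV[R]_d := \row_i limn (fun n => X n t i).
have YX e : 0 < e -> exists n0, forall n t i, 0 <= t < 1 -> (n0 <= n)%N ->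
    `|Y t 0 i - p n t 0 i| <= e.
  move=> e0; have [n0 H] := pcauchy e e0; exists n0 => n t i t01 n0n.
  apply/ler_addgt0Pr => e' e'0; rewrite mxE.
  have /cvgrPdist_le/(_ e' e'0) [m0 _ mP] := Xcvg t i.
  have := mP (n + m0)%N (leq_addl _ _); rewrite XE// => h.
  have := H n m0 t i t01 n0n => h'.
  rewrite -(subrKA (p (n + m0)%N t 0 i)) (le_trans (ler_normD _ _))//.
  by rewrite addrC lerD.
have mX n i : measurable_fun setT (fun t => X n t i).
  have [m _] := bmeas_walk L halfspace n 0 xpredT 0 (fun w => c (z w) 0 i).
  by apply: measurable_funM => //; exact: measurable_indic.
have Ycube t : unit_cube (Y t).
  move=> i; have [t01|t01] := boolP (0 <= t < 1); last first.
    rewrite mxE (_ : (fun n => _) = fun=> 0) ?lim_cst ?lexx ?ler01//.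
    by apply/funext => n; rewrite X0.
  apply/andP; split; apply/ler_addgt0Pr => e e0; have [n0 H] := YX e e0;
    have := H n0 t i t01 (leqnn _); rewrite ler_norml => /andP[h1 h2];
    have /andP[h3 h4] := c01 (z (W n0 t)) i; rewrite -/(p n0 t) in h3 h4; lra.
exists Y; split=> //.
- move=> i; apply: (@measurable_fun_cvg _ _ R setT (fun n t => X n t i)) => //.
  by move=> t _; rewrite mxE; exact: Xcvg.
move=> f cf bfY.
have leb1 : leb `[0%R, 1%R[ = 1%E.
  by rewrite lebesgue_measure_itv/= lte01 oppr0 adde0.
have leb01 : (leb `[0%R, 1%R[ < +oo)%E by rewrite leb1 ltry.
rewrite -Rintegral_itv_bndo_bndc; last exact: bmeas_integrable.
have bfc : (fun x => f (c x)) \in bounded_pred.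
  have [M _ fM] := contT_bounded cf.
  by apply/bounded_predP; exists M => x.
apply/eqP; rewrite -subr_eq0 -normr_eq0 eq_le normr_ge0 andbT.
apply/ler_addgt0Pr => e e0; rewrite add0r.
have e20 : 0 < e / 2 by rewrite divr_gt0.
have [delta d0 fdelta] := unif_continuous_unit_cube (proj2 cf) e20.
have [n1 H1] := bits_diam d0; have [n2 H2] := YX delta d0.
pose n := maxn n1 n2.
pose g w := f (c (z w)).
have cc x : unit_cube (c x) by move=> i; have /andP[-> /ltW ->] := c01 x i.
have bgW : bmeas (fun t => g (W n t)) by exact: bmeas_walk.
have bgb := bounded_pred_bits halfspace n 0 g.
have E : Rintegral leb `[0%R, 1%R[ (fun t => g (W n t)) =
    L (fun x => g (bits halfspace n 0 x)).
  have := integral_walk halfspace Lmean n 0 xpredT 0 g; rewrite add0r mass1 => ->.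
  by congr L; apply/funext => x; rewrite mul1r.
have h1 : `|Rintegral leb `[0%R, 1%R[ (fun t => -1 * g (W n t) + f (Y t))| <= e / 2.
  have cE a : a = Rintegral leb `[0%R, 1%R[ (fun=> a).
    by rewrite Rintegral_cst// [X in fine X]leb1 mulr1.
  have le t : `[0%R, 1%R[%classic t -> `|-1 * g (W n t) + f (Y t)| <= e / 2.
    rewrite /= in_itv/= => t01; rewrite addrC mulN1r; apply: fdelta => [|i].
      exact: Ycube.
    by apply: H2 => //; exact: leq_maxr.
  rewrite ler_norml [X in X <= _ <= _]cE [X in _ <= _ <= X]cE.
  apply/andP; split; apply: bmeas_le_Rintegral => //;
    try exact: bmeas_cst; try exact: bmeas_lin;
    by move=> t /le; rewrite ler_norml => /andP[].
have h2 : `|L (fun x => -1 * f (c x) + g (bits halfspace n 0 x))| <= e / 2.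
  have le x : `|-1 * f (c x) + g (bits halfspace n 0 x)| <= e / 2.
    rewrite addrC mulN1r distrC; apply: fdelta => // i.
    apply: (H1 n); first exact: leq_maxl.
    have sb : size (bits halfspace n 0 x) = n by rewrite size_map size_iota.
    by have := zP (bits halfspace n 0 x); rewrite sb => ->//; exists x.
  have bh : (fun x => -1 * f (c x) + g (bits halfspace n 0 x)) \in bounded_pred.
    exact: (bounded_pred_submod.2 (-1)).
  rewrite ler_norml; apply/andP; split.
    suff : L (fun x => -1 * (-1 * f (c x) + g (bits halfspace n 0 x))) <= e / 2.
      by rewrite (meanZ Lmean (-1) bh); lra.
    apply: Lmean.2; first by apply: bounded_predM => //; exact: bounded_pred_cst.
    by move=> x; have := le x; rewrite ler_norml => /andP[? _]; lra.
  by apply: Lmean.2 => // x; have := le x; rewrite ler_norml => /andP[].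
rewrite (Lmean.1 _ _ _ bfc bgb) in h2.
rewrite (bmeas_Rintegral_lin _ leb01)// E in h1.
move: h1 h2; rewrite !ler_norml => /andP[? ?] /andP[? ?].
by apply/andP; split; lra.
Qed.

End MeanRepresentation.

(** * Laws of random variables on the torus *)

Lemma row_of_tupleK {R : realType} {d : nat} (v : 'rV[R]_d) :
  row_of_tuple [tuple v 0 i | i < d] = v.
Proof. by apply/rowP => i; rewrite mxE tnth_mktuple. Qed.

(** Limits such as those of [mean_limit] may have coordinates equal to 1, so the law is that of
    [fracv (Y t)], which periodic functions do not distinguish from [Y t]. *)
Lemma torus_prob_law {R : realType} {d : nat} (Y : R -> 'rV[R]_d) :
  (forall i, measurable_fun setT (fun t => Y t 0 i)) ->
  exists eta : probability (d.-tuple R) R, torus_prob eta /\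
    forall f, contT f -> bmeas (fun t => f (Y t)) /\
      meas_int eta f = Rintegral (@lebesgue_measure R) `[0, 1] (fun t => f (Y t)).
Proof.
move=> mY.
pose tau t : d.-tuple R := [tuple fracv (Y t) 0 i | i < d].
have mtau : measurable_fun setT tau.
  apply/measurable_fun_tnthP => i.
  rewrite (_ : _ \o _ = fun t => Y t 0 i - (Num.floor (Y t 0 i))%:~R); last first.
    by apply/funext => t; rewrite /= tnth_mktuple mxE.
  apply: measurable_funB; first exact: mY.
  apply: (measurableT_comp (f := fun y : R => (Num.floor y)%:~R : R)); last exact: mY.
  apply: nondecreasing_measurable => // x y xy.
  by rewrite ler_int; exact: le_floor.
have [mf mfE] : exists h : {mfun measurableTypeR R >-> d.-tuple R},
    h = tau :> (_ -> _).
  pose tau' : measurableTypeR R -> d.-tuple R := tau.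
  have mtau' : measurable_fun setT tau' by exact: mtau.
  by exists (mfun_Sub (mem_set mtau')).
pose P : probability (measurableTypeR R) R := uniform_prob (@ltr01 R).
pose eta : probability (d.-tuple R) R := distribution P mf.
exists eta; split.
  suff E : mf @^-1` (~` cell) = set0.
    by rewrite /torus_prob -[LHS]/(P (mf @^-1` (~` cell))) E measure0.
  rewrite -subset0 => t /=; apply => i.
  by rewrite mfE tnth_mktuple; exact: fracv_itv.
move=> f cf.
have tauE t : f (row_of_tuple (tau t)) = f (Y t).
  by rewrite row_of_tupleK; apply: periodic_fracv; case: cf.
have bF := bmeas_contT cf.
have btau (F : d.-tuple R -> R) : bmeas F -> bmeas (fun t => F (tau t)).
  by move=> bF'; exact: (bmeas_comp bF' mtau).
have bY : bmeas (fun t => f (Y t)).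
  rewrite (_ : (fun _ => _) = fun t => f (row_of_tuple (tau t))); last exact/funext.
  exact: btau bF.
split=> //.
pose J (F : d.-tuple R -> R) := Rintegral eta setT F -
  Rintegral (@lebesgue_measure R) `[0%R, 1%R] (fun t => F (tau t)).
suff : J (fun x => f (row_of_tuple x)) = 0.
  rewrite /J -meas_intE => /eqP; rewrite subr_eq0 => /eqP ->.
  by apply: eq_Rintegral => t _.
apply: (bmeas_functional_eq0 (J := J) (K := 2)) => //.
- move=> a F G bF' bG; rewrite /J.
  rewrite (bmeas_Rintegral_lin (mu := eta) measurableT (prob_lty eta))//.
  rewrite (@I01_lin _ a (fun t => F (tau t)) (fun t => G (tau t)))//; try exact: btau.
  by ring.
- move=> F e bF' Fe; rewrite /J.
  have h1 : `|Rintegral eta setT F| <= e.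
    rewrite ler_norml -{1}[- e](Rintegral_prob_cst eta) -{2}[e](Rintegral_prob_cst eta).
    apply/andP; split; apply: bmeas_le_Rintegral => //; try exact: bmeas_cst;
      try exact: prob_lty;
      by move=> x _; have := Fe x; rewrite ler_norml => /andP[].
  have h2 : `|Rintegral (@lebesgue_measure R) `[0%R, 1%R] (fun t => F (tau t))| <= e.
    rewrite ler_norml -{1}[- e]I01_cst -{2}[e]I01_cst.
    apply/andP; split; apply: bmeas_le_Rintegral => //; try exact: bmeas_cst;
      try exact: lebesgue01_lty; try exact: btau;
      by move=> t _; have := Fe (tau t); rewrite ler_norml => /andP[].
  by rewrite (le_trans (ler_normB _ _))// (_ : 2 * e = e + e); [exact: lerD|ring].
- move=> B mB; rewrite /J /Rintegral.
  have -> : (\int[eta]_x (\1_B x)%:E)%E = eta B by rewrite integral_indic// setIT.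
  have mtB : measurable (tau @^-1` B) by rewrite -[X in measurable X]setTI; exact: mtau.
  apply/eqP; rewrite subr_eq0; apply/eqP; congr fine.
  rewrite -[LHS]/(P (mf @^-1` B)) mfE.
  rewrite -[LHS](_ : (\int[P]_t (\1_(tau @^-1` B) t)%:E)%E = _); last first.
    by rewrite integral_indic// setIT.
  rewrite integral_uniform//.
  - by rewrite subr0 invr1 mul1e.
  - by apply/measurable_EFinP; exact: measurable_indic.
Qed.

Lemma mean_representation {R : realType} {d : nat} {T : Type}
    (L : (T -> R) -> R) (c : T -> 'rV[R]_d) :
  is_mean L -> (forall x i, 0 <= c x 0 i < 1) ->
  exists eta : probability (d.-tuple R) R, torus_prob eta /\
    forall f, contT f -> meas_int eta f = L (fun x => f (c x)).
Proof.
move=> Lmean c01; have [Y [mY _ YL]] := mean_limit Lmean c01.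
have [eta [teta etaE]] := torus_prob_law mY.
exists eta; split=> // f cf; have [bf ->] := etaE _ cf.
exact: YL.
Qed.

(** * The eigenvalue *)

Lemma CkT_pred {R : realType} {d k : nat} (f : 'rV[R]_d -> R) :
  CkT k.+1 f -> CkT k f.
Proof.
move=> [pf Cf]; split=> // {pf}; elim: k f Cf => [|k IH] f [cf D] //.
by split=> // i; have [df Cf] := D i; split=> //; exact: IH.
Qed.

Section EigenvalueLimit.
Context {R : realType} {d : nat}.
Variables (H m : 'rV[R]_d -> R) (A : 'rV[R]_d -> 'rV[R]_d).
Hypothesis Cm : CkT 2 m.
Hypothesis CA : forall j : 'I_d, CkT 2 (fun x => A x 0 j).
Notation drift psi := (fun x => dotp (A x) (grad psi x)).

Lemma dotp_lin (u : 'rV[R]_d) a v w : dotp u (a *: v + w) = a * dotp u v + dotp u w.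
Proof.
rewrite /dotp mulr_sumr -big_split/=; apply: eq_bigr => i _.
by rewrite !mxE; ring.
Qed.

Lemma dotp0 (u : 'rV[R]_d) : dotp u 0 = 0.
Proof. by rewrite /dotp big1// => i _; rewrite mxE mulr0. Qed.

Lemma drift_lin a f g x : CkT 2 f -> CkT 2 g ->
  drift (fun y => a * f y + g y) x = a * drift f x + drift g x.
Proof. by move=> Cf Cg; rewrite /= (grad_lin _ _ Cf Cg) dotp_lin. Qed.

(** [mean_separation] is applied to the drifts, restricted to one representative per point of the
    torus. It yields both the measure and near-optimal [psi]; with [meas_int_drift_le], the easy
    half of the duality, these make [eta0] maximal. *)
Lemma invariant_dual : exists eta0 : probability (d.-tuple R) R,
  A_invariant A eta0 /\ forall delta, 0 < delta ->
    exists2 psi, CkT 2 psi & forall x, m x + drift psi x <= meas_int eta0 m + delta.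
Proof.
pose T := {x : 'rV[R]_d | forall i, 0 <= x 0 i < 1}.
pose frac x : T := exist _ (fracv x) (fracv_itv x).
pose G := [set g | exists2 psi, CkT 2 psi & g = fun t : T => drift psi (sval t)].
have cdrift psi : CkT 2 psi -> contT (drift psi) by exact: contT_dotp_grad.
have fracE f x : contT f -> f (sval (frac x)) = f x.
  by move=> [pf _]; exact: periodic_fracv.
have bT f : contT f -> (fun t : T => f (sval t)) \in bounded_pred.
  move=> /contT_bounded[M _ fM]; apply/bounded_predP; exists M => t; exact: fM.
have [||||L [Lmean LG Lm]] := @mean_separation R T G (fun t => m (sval t)).
- by apply: bT; exact: CkT_contT Cm.
- move=> _ [psi Cpsi ->]; split; first exact: bT (cdrift _ Cpsi).
  have [x0 x0min] := contT_min (CkT_contT Cpsi).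
  exists (frac x0); rewrite (fracE (drift psi))//; last exact: cdrift.
  by have [-> _] := min_grad_laplacian Cpsi x0min; rewrite dotp0.
- exists (fun=> 0); first exact: CkT_cst.
  apply/funext => t; rewrite (_ : grad _ _ = 0) ?dotp0//.
  by apply/rowP => i; rewrite !mxE /partial derive_cst.
- move=> a _ _ [f Cf ->] [g Cg ->]; exists (fun x => a * f x + g x).
    exact: CkT_lin.
  by apply/funext => t; rewrite drift_lin.
have [eta [teta etaE]] := mean_representation Lmean (fun t : T => svalP t).
exists eta; split.
  split=> // phi Cphi; rewrite etaE; last exact: cdrift.
  by apply: LG; exists phi.
move=> delta d0; have [_ [psi Cpsi ->] psiP] := Lm _ d0.
exists psi => // x; rewrite etaE; last exact: CkT_contT Cm.
by have := psiP (frac x); rewrite (fracE m) ?(fracE (drift psi))//;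
  [exact: cdrift|exact: CkT_contT Cm].
Qed.

Lemma meas_int_drift_le (eta : probability (d.-tuple R) R) psi K :
  A_invariant A eta -> CkT 2 psi ->
  (forall x, m x + drift psi x <= K) -> meas_int eta m <= K.
Proof.
move=> [_ inv] Cpsi le; rewrite -(meas_int_cst eta K) -[leLHS]addr0 -(inv _ Cpsi).
have cm := CkT_contT Cm; have cd := contT_dotp_grad CA Cpsi.
rewrite -[X in X + _]mul1r -meas_int_lin//; apply: meas_int_le.
- exact: contT_lin.
- exact: contT_cst.
- by move=> x; rewrite mul1r; exact: le.
Qed.

Definition eigenfunction (eps lam : R) phi := CkT 2 phi /\
  forall x, lam + eps * (- laplacian phi x + H (grad phi x)) +
    dotp (A x) (grad phi x) = - m x.

(* At a minimum of [phi - psi] the gradients agree and the Laplacians are ordered. *)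
Lemma eigenvalue_ge psi K : continuous H -> CkT 2 psi ->
  (forall x, m x + drift psi x <= K) ->
  exists C : R, forall (eps lam : R) phi, 0 < eps -> eigenfunction eps lam phi ->
    - K - eps * C <= lam.
Proof.
have arith (e l k C1 C2 lphi lpsi h D m0 : R) : 0 < e -> 0 <= - lpsi + lphi ->
    `|lpsi| <= C1 -> `|h| <= C2 -> l + e * (- lphi + h) + D = - m0 ->
    m0 + D <= k -> - k - e * (C1 + C2) <= l.
  move=> e0 ll; rewrite !ler_norml => /andP[l1 _] /andP[_ h2] eq0 le0.
  have : e * (- lphi + h) <= e * (C1 + C2) by rewrite ler_pM2l//; lra.
  lra.
move=> cH Cpsi leK.
have ch : contT (fun x => H (grad psi x)).
  exact: contT_comp_grad cH (CkT_pred Cpsi).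
have [C1 _ lapC] := contT_bounded (contT_laplacian Cpsi).
have [C2 _ HC] := contT_bounded ch.
(* The constant depends on [psi] alone, so it is uniform in [eps] and [phi]. *)
exists (C1 + C2) => eps lam phi eps0 [Cphi eqn].
pose u x := -1 * psi x + phi x.
have Cu : CkT 2 u by exact: CkT_lin.
have [x0 umin] := contT_min (CkT_contT Cu).
have [gu lu] := min_grad_laplacian Cu umin.
have gE : grad phi x0 = grad psi x0.
  by move: gu; rewrite (grad_lin _ _ Cpsi Cphi) scaleN1r addrC => /eqP;
    rewrite subr_eq0 => /eqP.
rewrite laplacian_lin// mulN1r in lu.
have := eqn x0; rewrite gE => eq0.
have := leK x0 => le0.
exact: (arith _ _ _ _ _ _ _ _ _ _ eps0 lu (lapC x0) (HC x0) eq0 le0).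
Qed.

(** Two integrations by parts move the Laplacian onto [rho]; as [laplacian rho] has integral zero,
    the mean of [phi] can be subtracted, and [C] is a sup bound of [laplacian rho]. The [H] term
    stays on the left because the oscillation bound needs it. *)
Lemma eigenvalue_le (eta : probability (d.-tuple R) R) rho :
  continuous H -> A_invariant A eta -> has_density eta rho -> CkT 2 rho ->
  exists2 C : R, 0 <= C & forall (eps lam : R) phi, 0 < eps -> eigenfunction eps lam phi ->
    lam + eps * meas_int eta (fun x => H (grad phi x)) <= - meas_int eta m +
      eps * (C * torus_int (fun x => `|phi x - torus_int phi|)).
Proof.
move=> cH [_ inv] dens Crho.
have [C C0 rhoC] := contT_bounded (contT_laplacian Crho).
exists C => // eps lam phi eps0 [Cphi eqn].
have cphi := CkT_contT Cphi; have cm := CkT_contT Cm.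
have clap := contT_laplacian Cphi; have clr := contT_laplacian Crho.
have cd := contT_dotp_grad CA Cphi.
have ch : contT (fun x => H (grad phi x)).
  exact: contT_comp_grad cH (CkT_pred Cphi).
have cc c := @contT_cst R d c.
have E : - meas_int eta m = lam + eps * meas_int eta (fun x => H (grad phi x))
    - eps * meas_int eta (laplacian phi).
  have : meas_int eta (fun x => -1 * m x + 0) =
    meas_int eta (fun x => eps * H (grad phi x) + (- eps * laplacian phi x +
      (1 * dotp (A x) (grad phi x) + lam))).
    congr (meas_int eta); apply/funext => x.
    by rewrite addr0 mulN1r -eqn; ring.
  have c1 : contT (fun x => 1 * dotp (A x) (grad phi x) + lam) by exact: contT_lin.
  have c2 : contT (fun x => - eps * laplacian phi x +
    (1 * dotp (A x) (grad phi x) + lam)) by exact: contT_lin.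
  rewrite !meas_int_lin//.
  by rewrite !meas_int_cst inv//; lra.
pose phib := torus_int phi.
have cpb : contT (fun x => -1 * phib + phi x) by apply: contTD.
have lapE : meas_int eta (laplacian phi) =
    torus_int (fun x => (-1 * phib + phi x) * laplacian rho x).
  rewrite (meas_int_density dens (CkT_contT Crho) clap) torus_int_green//.
  have -> : (fun x => (-1 * phib + phi x) * laplacian rho x) =
    (fun x => - phib * laplacian rho x + phi x * laplacian rho x).
    by apply/funext => x; ring.
  rewrite (torus_int_lin (- phib) clr (contTM cphi clr)).
  by rewrite torus_int_laplacian0// mulr0 add0r.
suff : meas_int eta (laplacian phi) <= C * torus_int (fun x => `|phi x - phib|).
  move=> h. have := ler_wpM2l (ltW eps0) h; rewrite E /phib; lra.
have cn : contT (fun x => `|phi x - phib|) by apply: contT_norm; exact: contTD.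
rewrite lapE -(torus_intZ C cn); apply: torus_int_le.
- exact: contTM.
- exact: contTM.
- move=> x; rewrite (le_trans (ler_norm _))// normrM mulrC mulN1r addrC.
  by rewrite ler_wpM2r.
Qed.

End EigenvalueLimit.

(** * A priori bound on the oscillation of eigenfunctions *)

Lemma convex_coercive_affine_minorant (R : realType) (cH : R -> R) :
  (forall M : R, exists r : R, forall a : R, r <= a -> M <= cH a) ->
  (forall a b t : R, 0 <= a -> 0 <= b -> 0 <= t <= 1 ->
     cH (t * a + (1 - t) * b) <= t * cH a + (1 - t) * cH b) ->
  (forall a : R, 0 <= a -> 0 <= cH a) -> cH 0 = 0 ->
  exists2 r : R, 0 < r & forall a, 0 <= a -> a / r - 1 <= cH a.
Proof.
move=> coercive convex cH_ge0 cH0; have [r0 r0P] := coercive 1.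
pose r := Num.max r0 1.
have r1 : 1 <= r by rewrite le_max lexx orbT.
have rpos : 0 < r by rewrite (lt_le_trans ltr01).
(* Up to [r] the affine function is non-positive. Beyond it, convexity between 0 and [a], together
   with [cH r >= 1], gives slope at least [1 / r]. *)
exists r => // a a0; have [ar|ra] := leP a r.
  rewrite (le_trans _ (cH_ge0 _ a0))// subr_le0 ler_pdivrMr// mul1r//.
have apos : 0 < a by rewrite (lt_trans rpos).
have := convex a 0 (r / a) a0 (lexx _).
rewrite divr_ge0 ?(ltW rpos) ?(ltW apos)// ler_pdivrMr// mul1r (ltW ra) => /(_ isT).
rewrite mulr0 addr0 divfK ?gt_eqF// cH0 mulr0 addr0 => h.
have : 1 <= r / a * cH a by rewrite (le_trans _ h)// r0P// le_max lexx.
rewrite mulrAC ler_pdivlMr// mul1r => h'.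
suff : a / r <= cH a by lra.
by rewrite ler_pdivrMr// mulrC.
Qed.

Lemma powR_small (R : realType) (b tau : R) : 0 < b -> 0 < tau ->
  exists2 e1 : R, 0 < e1 & forall e, 0 < e -> e < e1 -> e `^ b <= tau.
Proof.
move=> b0 t0; exists (tau `^ b^-1); first exact: powR_gt0.
move=> e e0 ee1.
rewrite -[leRHS](_ : (tau `^ b^-1) `^ b = _); last first.
  by rewrite -powRrM mulVf ?gt_eqF// powRr1// ltW.
by rewrite ge0_ler_powR ?nnegrE ?powR_ge0// ltW.
Qed.

(* With [s = eps `^ beta] the assumption on [H] turns [eps * H (grad phi)] into an
   upper bound for [H (grad (s phi))], so that the functional inequality
   controls [s * ||phi - mean||_1], whence [eps * ||phi - mean||_1] is
   [O(eps `^ (1 - beta))]. *)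
Lemma oscillation_small (R : realType) (d : nat) (H m : 'rV[R]_d -> R)
    (A : 'rV[R]_d -> 'rV[R]_d) (eta : probability (d.-tuple R) R) rho tau :
  assumptions_H H -> CkT 2 m -> (forall j, CkT 2 (fun x => A x 0 j)) ->
  A_invariant A eta -> has_density eta rho -> CkT 2 rho -> (forall x, 0 < rho x) ->
  0 < tau -> exists2 e1, 0 < e1 & forall eps lam phi, 0 < eps -> eps < e1 ->
    eigenfunction H m A eps lam phi ->
    eps * torus_int (fun x => `|phi x - torus_int phi|) <= tau.
Proof.
move=> [/Ck_continuous cH [H0 [Hpos [_ [[cal [_ [coer [conv [cal0 [cal00 [_ ineq]]]]]]]
  [beta [/andP[b0 b1] Hscale]]]]]]] Cm CA inv dens Crho rho0 tau0.
have [r r0 calr] := convex_coercive_affine_minorant coer conv cal0 cal00.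
have [C C0 upper] := eigenvalue_le Cm CA cH inv dens Crho.
have cm := CkT_contT Cm; have crho := CkT_contT Crho.
have [xm xmin] := contT_min crho; pose c0 := rho xm; have c00 : 0 < c0 := rho0 xm.
have [K0 _ mK0] := contT_bounded cm.
have C0T : CkT 2 (fun _ : 'rV[R]_d => 0 : R) by exact: CkT_cst.
have grad0 (x : 'rV[R]_d) : grad (fun _ : 'rV[R]_d => 0 : R) x = 0.
  by apply/rowP => i; rewrite !mxE /partial derive_cst.
(* Comparison with [psi = 0] gives a crude lower bound on the eigenvalue. *)
have mle x : m x + dotp (A x) (grad (fun _ : 'rV[R]_d => 0 : R) x) <= K0.
  by rewrite grad0 dotp0 addr0 (le_trans (ler_norm _)).
have [C' lower] := eigenvalue_ge cH C0T mle.
(* For [eps < 1], [B] bounds [- lam - meas_int eta m] from above. *)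
pose B := `|K0 + `|C'| - meas_int eta m|.
have B0 : 0 <= B by exact: normr_ge0.
(* [K] bounds [N = s * n] below: it solves [c0 * N / (2 * r) <= B + c0], obtained once half of the
   linear term has been absorbed. *)
pose K := 2 * r * (B + c0) / c0.
have K0' : 0 <= K.
  rewrite /K; apply: divr_ge0; last exact: ltW.
  by apply: mulr_ge0; [apply: mulr_ge0 => //; exact: ltW|apply: addr_ge0 => //; exact: ltW].
(* For [sig] below this threshold the error [C * sig * N] takes at most half of [c0 * N / r];
   [C + 1] avoids dividing by zero. *)
have sig0 : 0 < c0 / (2 * r * (C + 1)).
  by apply: divr_gt0 => //; apply: mulr_gt0; [exact: mulr_gt0|exact: ltr_wpDl].
have [e1 e10 e1P] := @powR_small R (1 - beta) _ ltac:(by rewrite subr_gt0) sig0.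
have [e2 e20 e2P] := @powR_small R (1 - beta) (tau / (K + 1))
  ltac:(by rewrite subr_gt0) ltac:(by rewrite divr_gt0// ltr_wpDl).
exists (Num.min 1 (Num.min e1 e2)); first by rewrite !lt_min ltr01 e10.
move=> eps lam phi eps0; rewrite !lt_min => /and3P[eps1 epse1 epse2] eig.
have [Cphi eqn] := eig.
set n := torus_int (fun x => `|phi x - torus_int phi|).
pose s := eps `^ beta; pose sig := eps `^ (1 - beta).
have s0 : 0 < s by exact: powR_gt0.
have sg0 : 0 < sig by exact: powR_gt0.
have ssig : s * sig = eps.
  rewrite /s /sig -powRD; first by rewrite addrC subrK powRr1// ltW.
  by apply/implyP => _; rewrite gt_eqF.
have cphi := CkT_contT Cphi.
have ch : contT (fun x => H (grad phi x)).
  exact: contT_comp_grad cH (CkT_pred Cphi).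
have H_ge0 p : 0 <= H p by have [->|/Hpos/ltW//] := eqVneq p 0; rewrite H0.
have cphib : contT (fun x => phi x - torus_int phi).
  by apply: contTD => //; exact: contT_cst.
have cn : contT (fun x => `|phi x - torus_int phi|) by exact: contT_norm.
have n0 : 0 <= n.
  by rewrite -(@torus_int_cst R d 0); apply: torus_int_le => //; exact: contT_cst.
(* The trailing zero gives [u] the shape expected by [CkT_lin] and [grad_lin]. *)
pose u x := s * phi x + 0.
have Cu : CkT 2 u by exact: (CkT_lin s Cphi C0T).
have uE : torus_int (fun x => `|u x - torus_int u|) = s * n.
  have -> : torus_int u = s * torus_int phi.
    by rewrite /u torus_int_lin ?torus_int_cst ?addr0//; exact: contT_cst.
  rewrite -(torus_intZ s cn); congr torus_int; apply/funext => x.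
  by rewrite /u addr0 -mulrBr normrM gtr0_norm.
have := ineq u Cu; rewrite uE => Hu.
have gradu x : grad u x = s *: grad phi x.
  by rewrite (grad_lin _ _ Cphi C0T) grad0 addr0.
have chu : contT (fun x => H (grad u x)).
  exact: contT_comp_grad cH (CkT_pred Cu).
have Hu2 : torus_int (fun x => H (grad u x)) <= eps * torus_int (fun x => H (grad phi x)).
  rewrite -(torus_intZ eps ch); apply: torus_int_le => //.
    by apply: contTM => //; exact: contT_cst.
  by move=> x; rewrite gradu; apply: Hscale; rewrite eps0 eps1.
have Hrho : c0 * torus_int (fun x => H (grad phi x)) <= meas_int eta (fun x => H (grad phi x)).
  rewrite (meas_int_density dens crho ch) -(torus_intZ c0 ch); apply: torus_int_le.
  - by apply: contTM => //; exact: contT_cst.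
  - exact: contTM.
  - by move=> x; rewrite mulrC ler_wpM2l// xmin.
have up := upper _ _ _ eps0 eig; rewrite -/n in up.
have lo := lower _ _ _ eps0 eig.
have cN := calr _ (mulr_ge0 (ltW s0) n0).
set N := s * n in Hu uE cN.
have N0 : 0 <= N by rewrite mulr_ge0// ltW.
have epsn : eps * n = sig * N by rewrite /N -ssig; ring.
have epsC' : eps * C' <= `|C'|.
  have [C'0|C'0] := leP 0 C'.
    by rewrite ger0_norm// ler_piMl// ltW.
  by rewrite (le_trans _ (normr_ge0 _))// pmulr_rle0// ltW.
(* Chain: affine minorant, functional inequality for [u], scaling of [H], lower bound [c0] of [rho],
   and finally the two bounds on [lam]. *)
have step : c0 * (N / r - 1) <= B + C * (sig * N).
  have h1 : c0 * (N / r - 1) <= c0 * (eps * torus_int (fun x => H (grad phi x))).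
    by rewrite ler_pM2l// (le_trans cN)// (le_trans Hu).
  have h2 := ler_wpM2l (ltW eps0) Hrho.
  have h3 : eps * (C * n) = C * (sig * N) by rewrite mulrCA epsn.
  have h4 : K0 + `|C'| - meas_int eta m <= B by exact: ler_norm.
  rewrite h3 in up; lra.
have sigC : C * sig <= c0 / (2 * r).
  have := e1P _ eps0 epse1; rewrite -/sig => h.
  have rC : 0 < C + 1 by rewrite ltr_wpDl.
  rewrite (le_trans (_ : _ <= (C + 1) * sig))//.
    by rewrite ler_pM2r// lerDl.
  rewrite (le_trans (ler_wpM2l (ltW rC) h))// le_eqVlt; apply/orP; left.
  by apply/eqP; field; rewrite !gt_eqF.
have NK : N <= K.
  have h1 : C * (sig * N) <= c0 / (2 * r) * N by rewrite mulrA ler_wpM2r.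
  have h2 : c0 * (N / r - 1) = 2 * (c0 / (2 * r) * N) - c0.
    by field; rewrite gt_eqF.
  have h3 : c0 / (2 * r) * N <= B + c0 by lra.
  rewrite /K ler_pdivlMr//.
  have r20 : 0 <= 2 * r by apply: mulr_ge0 => //; exact: ltW.
  have := ler_wpM2l r20 h3.
  by rewrite (_ : 2 * r * (c0 / (2 * r) * N) = N * c0)//; field; rewrite gt_eqF.
rewrite epsn (le_trans (ler_wpM2l (ltW sg0) NK))//.
have := e2P _ eps0 epse2; rewrite -/sig ler_pdivlMr ?ltr_wpDl// => h.
by rewrite (le_trans _ h)// ler_pM2l// lerDl.
Qed.

(** * Convergence of the eigenvalue *)

Unset Implicit Arguments.

Theorem theorem1p10 (R : realType) (d : nat)
  (H : 'rV[R]_d -> R) (m : 'rV[R]_d -> R) (A : 'rV[R]_d -> 'rV[R]_d)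
  (lam : R -> R) :
  assumptions_H H ->
  CkT 2 m ->
  (forall j : 'I_d, CkT 2 (fun x => A x 0 j)) ->
  (* (i) an A-invariant probability measure with smooth positive density *)
  (exists (eta : probability (d.-tuple R) R) (rho : 'rV[R]_d -> R),
     A_invariant A eta /\ has_density eta rho /\ smoothT rho /\
     (forall x, 0 < rho x)) ->
  (* (ii) A-invariant measures with C^2 density are weak-* dense in P_A *)
  (forall eta : probability (d.-tuple R) R, A_invariant A eta ->
     forall (k : nat) (fs : 'I_k -> 'rV[R]_d -> R),
       (forall i, contT (fs i)) ->
       forall delta : R, 0 < delta ->
       exists (eta' : probability (d.-tuple R) R) (rho : 'rV[R]_d -> R),
         A_invariant A eta' /\ has_density eta' rho /\ CkT 2 rho /\
         forall i, `|meas_int eta' (fs i) - meas_int eta (fs i)| < delta) ->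
  (* lam eps is the eigenvalue lambda_H(eps, A) *)
  (forall eps : R, 0 < eps -> is_eigenvalue H A m eps (lam eps)) ->
  exists eta0 : probability (d.-tuple R) R,
    A_invariant A eta0 /\
    (forall eta : probability (d.-tuple R) R, A_invariant A eta ->
       meas_int eta m <= meas_int eta0 m) /\
    lam eps @[eps --> 0^'+] --> - meas_int eta0 m.
Proof.
move=> HH Cm CA [eta1 [rho1 [inv1 [dens1 [[prho1 srho1] rho1_gt0]]]]] dense eig.
have cH : continuous H by case: HH => /Ck_continuous.
have H_ge0 p : 0 <= H p.
  have [_ [H0 [Hpos _]]] := HH.
  by have [->|/Hpos/ltW//] := eqVneq p 0; rewrite H0.
have cm := CkT_contT Cm.
have [eta0 [inv0 dual]] := invariant_dual Cm CA.
exists eta0; split=> //; split.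
  (* A [psi] that is near-optimal for [eta0] bounds the integral of [m] against every invariant
     measure. *)
  move=> eta inv; apply/ler_addgt0Pr => delta /dual[psi Cpsi].
  exact: meas_int_drift_le.
apply/cvgrPdist_le => e e0.
have e20 : 0 < e / 2 by rewrite divr_gt0.
have [psi Cpsi psiM] := dual _ e20.
have [C lower] := eigenvalue_ge cH Cpsi psiM.
(* Density is used for the single test function [m]. One half of [e] pays for replacing [eta0] by
   [eta'], the other for the oscillation term. *)
have [eta' [rho [inv' [dens' [Crho close]]]]] :=
  dense eta0 inv0 1 (fun=> m) (fun=> cm) _ e20.
have := close ord0; rewrite ltr_norml /= => /andP[close1 _].
have [C' C'0 upper] := eigenvalue_le Cm CA cH inv' dens' Crho.
have C'1 : 0 < C' + 1 by rewrite ltr_wpDl.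
have Crho1 : CkT 2 rho1 by split; last exact: srho1.
(* The oscillation is bounded through the positive density [rho1]; the tolerance makes [C'] times it
   at most [e / 2]. *)
have [|e1 e10 osc] := @oscillation_small R d H m A eta1 rho1 (e / 2 / (C' + 1))
  HH Cm CA inv1 dens1 Crho1 rho1_gt0; first by rewrite divr_gt0.
have Cabs : 0 < `|C| + 1 by rewrite ltr_wpDl.
(* Below [e2] the error [eps * C] of the lower bound is at most [e / 2]. *)
pose e2 := e / 2 / (`|C| + 1).
have e2_gt0 : 0 < e2 by rewrite divr_gt0.
near=> eps.
have eps0 : 0 < eps by near: eps; exact: nbhs_right_gt.
have epse1 : eps < e1 by near: eps; exact: nbhs_right_lt.
have epse2 : eps < e2 by near: eps; exact: nbhs_right_lt.
have [phi eigphi] := eig _ eps0.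
have lo := lower _ _ _ eps0 eigphi.
have up := upper _ _ _ eps0 eigphi.
have os := osc _ _ _ eps0 epse1 eigphi.
set n := torus_int _ in up os.
have Hphi : 0 <= eps * meas_int eta' (fun x => H (grad phi x)).
  apply: mulr_ge0; first exact: ltW.
  rewrite -(meas_int_cst eta' 0); apply: meas_int_le => //; first exact: contT_cst.
  by have [Cphi _] := eigphi; exact: contT_comp_grad cH (CkT_pred Cphi).
have h1 : eps * (C' * n) <= e / 2.
  rewrite mulrCA; move: os; rewrite ler_pdivlMr// => os.
  apply: le_trans os; rewrite mulrC; apply: ler_wpM2l; last by rewrite lerDl.
  apply: mulr_ge0; first exact: ltW.
  rewrite -(@torus_int_cst R d 0).
  have [Cphi _] := eigphi; have cphi := CkT_contT Cphi.
  apply: torus_int_le => //; first exact: contT_cst.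
  by apply: contT_norm; apply: contTD => //; exact: contT_cst.
have h2 : eps * C <= e / 2.
  move: (ltW epse2); rewrite /e2 ler_pdivlMr// => h.
  apply: le_trans h; apply: ler_wpM2l; first exact: ltW.
  by rewrite (le_trans (ler_norm _))// lerDl.
rewrite ler_norml; apply/andP; split; clear -lo up h1 h2 Hphi close1 e0; lra.
Unshelve. all: by end_near.
Qed.
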